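(* Let $m\ge 1$ be an integer, let $c \geq 2$ and $\tau \in [0, 3/2]$. Then the delayed KPP-Fisher reaction-diffusion equation $$u_t(t,x) = \Delta u(t,x) + u(t,x)\bigl(1-u(t-\tau,x)\bigr), \quad u \geq 0,\ x \in \mathbb{R}^m,$$ has at least one positive traveling front solution with speed $c$, i.e. for every $\nu\in\mathbb{R}^m$ with $|\nu|=1$ it has a solution $u(t,x)=\phi(\nu\cdot x+ct)$ with a positive profile $\phi:\mathbb{R}\to(0,\infty)$ satisfying $\phi(-\infty)=0$ and $\phi(+\infty)=1$.
   Context: A positive traveling front solution with speed $c>0$ is a smooth positive classical solution, defined for all $t\in\mathbb{R}$, $x\in\mathbb{R}^m$, of the form $u(t,x)=\phi(\nu\cdot x+ct)$, $|\nu|=1$, whose profile $\phi$ satisfies $\lim_{s\to-\infty}\phi(s)=0$ and $\lim_{s\to+\infty}\phi(s)=1$. The profile is not required to be monotone. Equivalently, $\phi$ satisfies $\phi''(s)-c\phi'(s)+\phi(s)(1-\phi(s-c\tau))=0$ for all $s\in\mathbb{R}$. *)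

(* Defs.v *)
From HB Require Import structures.
From mathcomp Require Import all_boot all_order all_algebra.
From mathcomp Require Import all_classical all_reals all_analysis.

Set Implicit Arguments.
Unset Strict Implicit.
Unset Printing Implicit Defensive.

Import Order.TTheory GRing.Theory Num.Theory.
Import numFieldNormedType.Exports.

Local Open Scope classical_set_scope.
Local Open Scope ring_scope.

Definition dot (R : realType) (m : nat) (x y : 'rV[R]_m) : R :=
  \sum_(i < m) x 0 i * y 0 i.

(* The library norm on ['rV[R]_m] is the sup norm. *)
Definition eucl_norm (R : realType) (m : nat) (x : 'rV[R]_m) : R :=
  Num.sqrt (dot x x).

(* On finite-dimensional [V] this is the usual class C^k: iterated directional
   derivatives up to order [k] exist everywhere and are continuous. *)
Fixpoint class_C (R : realType) (V : normedModType R) (k : nat) (f : V -> R)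
    : Prop :=
  continuous f /\
  match k with
  | 0 => True
  | k'.+1 => forall v : V, (forall x, derivable f x v) /\ class_C k' ('D_v f)
  end.

Definition smooth (R : realType) (V : normedModType R) (f : V -> R) : Prop :=
  forall k : nat, class_C k f.

Definition laplacian (R : realType) (m : nat) (f : 'rV[R]_m -> R)
    (x : 'rV[R]_m) : R :=
  \sum_(i < m) 'D_(delta_mx 0 i) ('D_(delta_mx 0 i) f) x.

(* Entire solutions, i.e. defined for all times. The derivatives below are
   total functions; joint smoothness of [u] in [(t, x)] ensures that they are
   genuine derivatives. *)
Definition positive_classical_solution (R : realType) (m : nat) (tau : R)
    (u : R -> 'rV[R]_m -> R) : Prop :=
  [/\ smooth (fun p : R * 'rV[R]_m => u p.1 p.2),
      forall t x, 0 < u t x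
    & forall t x, derive1 (fun s => u s x) t =
        laplacian (u t) x + u t x * (1 - u (t - tau) x)].

Definition front_profile (R : realType) (phi : R -> R) : Prop :=
  [/\ forall s, 0 < phi s,
      phi s @[s --> -oo] --> (0 : R)
    & phi s @[s --> +oo] --> (1 : R)].

Definition positive_traveling_front (R : realType) (m : nat) (c tau : R)
    (nu : 'rV[R]_m) (u : R -> 'rV[R]_m -> R) : Prop :=
  positive_classical_solution tau u /\
  exists phi : R -> R,
    front_profile phi /\ forall t x, u t x = phi (dot nu x + c * t).

(* Main.v *)
Require Import Defs.
From mathcomp Require Import all_boot all_order all_algebra.
From mathcomp Require Import all_classical all_reals all_analysis.
From mathcomp Require Import ring lra zify.

Set Implicit Arguments.
Unset Strict Implicit.
Unset Printing Implicit Defensive.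

Import Order.TTheory GRing.Theory Num.Theory.
Import numFieldNormedType.Exports.

Local Open Scope classical_set_scope.
Local Open Scope ring_scope.

(** Let [eps = c ^- 2] and let [v] be the profile in the variable [s / c]; then
    [eps v'' - v' + v (1 - v (s - tau)) = 0]. Writing [v = exp w] and [p = w'] turns
    this into [eps p' = p - eps p^2 - 1 + exp (w (s - tau))], where
    [0 < eps <= 1 / 4], and the theorem asks for a solution on the whole line with
    [w] tending to minus infinity on the left and to zero on the right.

    Existence ([entire_solution]) is a shooting argument. A slope equal to
    [mu = (2 eps)^-1] does not decrease, which is the condition [eps <= 1 / 4],
    and one equal to [- Q], for a large [Q], does not increase. Hence, by
    continuity, the initial slope can be chosen so that the slope stays in
    [[- Q, mu]] for as long as desired. The argument is carried out for the Euler scheme, where continuity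
    in the initial slope is immediate. Below level [- 1] the slope is at least
    [1 / 4], since a smaller one would drop out of the range; so orbits climb,
    and time can be shifted such that they reach level [- 1] at time [0]. Orbits
    that start lower and lower with smaller and smaller steps converge pointwise
    along an ultrafilter, and uniform Taylor estimates make the limit an entire
    solution ([approximate_solution]). The exponential is capped in the scheme,
    but a solution that reached the cap would have a slope growing beyond [mu]
    ([cap_inactive]).

    Convergence ([converges_to_zero]) follows Wright's treatment of the delayed
    logistic equation. Let [M] and [m] be the limits superior of [w] and [- w];
    both are nonnegative and finite. At a minimum below zero or a maximum
    above zero the delayed level has the opposite sign, so [w] has a zero within
    the last [tau <= 3 / 2] units of time. Integration from this zero bounds
    the depth of troughs by the height of earlier crests, [m <= trough_map M]
    ([trough_bound]), and the height of crests by the depth of earlier troughs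
    ([crest_bound]). For crests the term [eps p'] delays the response of the
    slope, and a comparison with the linear equation [eps l' = g - k l] shows that
    this does no harm: once crude bounds have given [m < 2], still
    [M <= 3 m / (3 + 2 m)]. As [trough_map M < 3 M / (3 - 2 M)] for [0 < M <= 1],
    both limits vanish ([no_two_cycle]).

    The equation makes [v] smooth, and the front is
    [u t x = v (t + nu . x / c)]. *)

Ltac nonneg := repeat first
  [ assumption | by apply/ltW | exact: ler0n | exact: sqr_ge0 | exact: expR_ge0
  | exact: ler01 | rewrite subr_ge0 | apply: addr_ge0 | apply: mulr_ge0 | apply: divr_ge0
  | apply: exprn_ge0 | rewrite invr_ge0 | done ].

(** * Calculus on the line *)

Section Calculus.
Context {R : realType}.
Implicit Types (f g df dg : R -> R) (a b x y : R).

Lemma is_derive_bound f x d : is_derive x 1 f d ->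
  forall e, 0 < e -> exists2 r : R, 0 < r &
    forall y, `|y - x| < r -> `|f y - f x - d * (y - x)| <= e * `|y - x|.
Proof.
move=> fd e e0.
have [df dE] := fd.
move: df; rewrite derivable_nbhsP dE => /eqaddoP /(_ e e0).
rewrite -nbhs_nearE => /nbhs_ballP[r /= r0 rP]; exists r => // y yr.
have /= := rP (y - x); rewrite -ball_normE /= sub0r normrN => /(_ yr).
rewrite /= !fctE /= /GRing.scale /= mulr1 subrK => H.
by rewrite opprD addrA (mulrC _ d) in H.
Qed.

(** Local quadratic Taylor estimates are what survives a pointwise limit; they
    give the derivative back. *)
Lemma is_derive_of_bound f x d K :
  (forall y, `|y - x| <= 1 ->
    `|f y - f x - d * (y - x)| <= K * (y - x) ^+ 2) ->
  is_derive x 1 f d.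
Proof.
move=> H.
suff : (fun h => h^-1 *: ((f \o shift x) (h *: (1:R)) - f x)) @ 0^' --> d.
  move=> c; split; first by apply/cvg_ex; exists d.
  exact: cvg_lim c.
apply/cvgrPdist_le => /= e e0.
have K0 : 0 <= K.
  have := H (x + 1); have -> : x + 1 - x = 1 by ring.
  by rewrite normr1 expr1n !mulr1 => /(_ (lexx _)); apply: le_trans.
near=> h.
have h0 : h != 0 by near: h; exact: nbhs_dnbhs_neq.
have h1 : `|h| <= 1 by near: h; apply: dnbhs0_le.
have := H (h + x); rewrite addrK => /(_ h1) Hh.
rewrite /GRing.scale /= mulr1.
have -> : d - h^-1 * (f (h + x) - f x) = - h^-1 * (f (h + x) - f x - d * h).
  by field.
rewrite normrM normrN normfV ler_pdivrMl ?normr_gt0 //.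
apply: le_trans Hh _.
rewrite -real_normK ?num_real // expr2 mulrA mulrC ler_pM2l ?normr_gt0 //.
have : `|h| <= e / (K + 1).
  near: h; apply: dnbhs0_le; rewrite divr_gt0 //; lra.
have K1 : 0 < K + 1 by lra.
rewrite ler_pdivlMr // => he.
by have := normr_ge0 h; nra.
Unshelve. all: by end_near. Qed.

Lemma is_derive_continuous f x d : is_derive x 1 f d -> {for x, continuous f}.
Proof. by case=> + _; move/derivable1_diffP/differentiable_continuous. Qed.

Lemma within_continuous f a b : (forall x, a <= x <= b -> {for x, continuous f}) ->
  {within `[a, b], continuous f}.
Proof.
move=> H; apply: continuous_in_subspaceT => x.
by rewrite inE /= in_itv /= => /H.
Qed.

Lemma continuous_dist f x : {for x, continuous f} ->
  forall e, 0 < e -> exists2 r : R, 0 < r & forall y, `|y - x| < r -> `|f y - f x| < e.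
Proof.
move=> /cvgrPdist_lt fx e e0; have := fx e e0.
rewrite -nbhs_nearE => /nbhs_ballP[r /= r0 rP]; exists r => // y yr.
by have := rP y; rewrite -ball_normE /= distrC => /(_ yr); rewrite distrC.
Qed.

Section MeanValue.
Variables (f df : R -> R) (a b : R).
Hypothesis ab : a <= b.
Hypothesis fD : forall x, a <= x <= b -> is_derive x 1 f (df x).

Lemma mean_value : exists2 c, a <= c <= b & f b - f a = df c * (b - a).
Proof.
have [||c cab E] := @MVT_segment R f df a b ab.
- by move=> x; rewrite in_itv /= => /andP[? ?]; apply: fD; rewrite !ltW.
- by apply: within_continuous => x /fD /is_derive_continuous.
by exists c; [move: cab; rewrite in_itv|].
Qed.

Lemma increment_le K : (forall x, a <= x <= b -> df x <= K) ->
  f b - f a <= K * (b - a).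
Proof.
move=> dK; have [c /dK cK ->] := mean_value.
by rewrite ler_wpM2r // subr_ge0.
Qed.

Lemma increment_ge K : (forall x, a <= x <= b -> K <= df x) ->
  K * (b - a) <= f b - f a.
Proof.
move=> dK; have [c /dK cK ->] := mean_value.
by rewrite ler_wpM2r // subr_ge0.
Qed.

End MeanValue.

Lemma derive_le f df g dg a b : a <= b ->
  (forall x, a <= x <= b -> is_derive x 1 f (df x)) ->
  (forall x, a <= x <= b -> is_derive x 1 g (dg x)) ->
  (forall x, a <= x <= b -> df x <= dg x) -> f b - f a <= g b - g a.
Proof.
move=> ab fD gD dfg.
have D x : a <= x <= b -> is_derive x 1 (f - g) (df x - dg x).
  by move=> xab; have := fD x xab; have := gD x xab; move=> ? ?; exact: is_deriveB.
have := increment_le ab D (K := 0).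
rewrite mul0r !fctE => H.
suff : f b - g b - (f a - g a) <= 0 by lra.
by apply: H => x /dfg; lra.
Qed.

(** Real induction: a property of points that is inherited by the supremum of
    an initial segment and can always be pushed a little to the right holds on
    the whole interval. *)
Lemma real_induction (P : R -> Prop) a b : a <= b ->
  (forall x, a <= x <= b -> (forall y, a <= y < x -> P y) -> P x) ->
  (forall x, a <= x < b -> (forall y, a <= y <= x -> P y) ->
     exists2 r : R, 0 < r & forall y, x < y < x + r -> P y) ->
  forall x, a <= x <= b -> P x.
Proof.
move=> ab Pl Pr.
pose S : set R := [set x | a <= x <= b /\ forall y, a <= y <= x -> P y].
have Pa : P a.
  by apply: Pl => [|y]; [rewrite lexx|case/andP=> /le_lt_trans h /h; rewrite ltxx].
have Sa : S a.
  split; first by rewrite lexx.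
  by move=> y /andP[ay ya]; have -> : y = a by apply/eqP; rewrite eq_le ya ay.
have Sb : has_sup S by split; [exists a|exists b => x [/andP[]]].
pose s := sup S.
have as_ : a <= s by apply: ub_le_sup => //; exact: Sb.2.
have sb : s <= b by apply: ge_sup => //; [exists a|move=> x [/andP[]]].
have Ps y : a <= y < s -> P y.
  move=> /andP[ay ys].
  have e0 : 0 < s - y by rewrite subr_gt0.
  have [z [zab zP] yz] := sup_adherent e0 Sb.
  by apply: zP; rewrite ay /= ltW //; move: yz; rewrite opprB addrC subrK.
have Pss : P s by apply: Pl => //; rewrite as_ sb.
have Ps' y : a <= y <= s -> P y.
  by move=> /andP[ay]; rewrite le_eqVlt => /orP[/eqP->//|ys]; apply: Ps; rewrite ay.
move: sb; rewrite le_eqVlt => /orP[/eqP sb|sb]; first by move=> x; rewrite -sb; exact: Ps'.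
have asb : a <= s < b by rewrite as_ sb.
have [r r0 rP] := Pr s asb Ps'.
have : S (Num.min b (s + r / 2)).
  have m1 : s < Num.min b (s + r / 2) by rewrite lt_min sb ltrDl divr_gt0.
  split; first by rewrite ge_min lexx andbT (le_trans as_) // ltW.
  move=> y /andP[ay]; rewrite le_min => /andP[_ yr].
  have [ys|sy] := leP y s; first by apply: Ps'; rewrite ay.
  by apply: rP; rewrite sy /=; lra.
move/(ub_le_sup Sb.2); rewrite -/s ge_min.
case/orP; [by move=> /(lt_le_trans sb); rewrite ltxx|by lra].
Qed.

(** A function that is nonnegative at [a] and increases whenever it comes back
    to zero stays nonnegative. *)
Lemma trapped f df a b :
  (forall x, a <= x <= b -> is_derive x 1 f (df x)) -> 0 <= f a ->
  (forall x, a <= x < b -> (forall y, a <= y <= x -> 0 <= f y) -> f x = 0 ->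
     0 < df x) ->
  forall x, a <= x <= b -> 0 <= f x.
Proof.
move=> fD fa H x axb.
have ab : a <= b by case/andP: axb => /le_trans h /h.
move: x axb; apply: real_induction => // x /andP[ax xb] fx.
  (* A negative value would persist slightly to the left, by continuity. *)
  have axb : a <= x <= b by rewrite ax.
  move: ax; rewrite le_eqVlt => /orP[/eqP<-//|ax].
  rewrite leNgt; apply/negP => fx0.
  have [|r r0 rP] := continuous_dist (is_derive_continuous (fD x axb)) (e := - f x).
    by rewrite oppr_gt0.
  pose y := Num.max a (x - r / 2).
  have yx : y < x by rewrite gt_max ax ltrBlDr ltrDl divr_gt0.
  have ay : a <= y by rewrite le_max lexx.
  have yr : x - r / 2 <= y by rewrite le_max lexx orbT.
  have := fx y; rewrite ay yx => /(_ isT).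
  have : `|y - x| < r by rewrite distrC gtr0_norm; lra.
  by move=> /rP; rewrite ltr_norml => /andP[_]; lra.
have axb : a <= x <= b by rewrite ax ltW.
have : 0 <= f x by apply: fx; rewrite ax lexx.
rewrite le_eqVlt => /orP[/eqP fx0|fx0].
  (* At a zero the positive derivative pushes the function up. *)
  have dx : 0 < df x by apply: H => //; rewrite ax.
  have [|r r0 rP] := is_derive_bound (fD x axb) (e := df x / 2); first lra.
  exists r => // y /andP[xy yr].
  have : `|y - x| < r by rewrite gtr0_norm; lra.
  move=> /rP; rewrite -fx0 (gtr0_norm (x := y - x)); last lra.
  by rewrite ler_norml => /andP[+ _]; nra.
have [r r0 rP] := continuous_dist (is_derive_continuous (fD x axb)) fx0.
exists r => // y /andP[xy yr].
have : `|y - x| < r by rewrite gtr0_norm; lra.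
by move=> /rP; rewrite ltr_norml => /andP[+ _]; lra.
Qed.

(** A function whose derivative exceeds [c] as long as it stays above its
    initial value grows at least linearly. *)
Lemma pushed_up f df a b (c : R) : a <= b -> 0 <= c ->
  (forall x, a <= x <= b -> is_derive x 1 f (df x)) ->
  (forall x, a <= x <= b -> f a <= f x -> c < df x) ->
  f a + c * (b - a) <= f b.
Proof.
move=> ab c0 fD H.
have fa x : a <= x <= b -> 0 <= f x - f a.
  apply: (@trapped (fun x => f x - f a) df) => [y yab||y /andP[ay yb] fy fya].
  - have -> : df y = df y - 0 by rewrite subr0.
    by have := fD y yab => ?; apply: is_deriveB.
  - by rewrite subrr.
  - by apply: le_lt_trans c0 _; apply: H; lra.
have := increment_ge ab fD (K := c).
rewrite lerBrDl; apply => x xab; apply/ltW/H => //.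
by have := fa x xab; lra.
Qed.

Lemma pushed_down f df a b (c : R) : a <= b -> 0 <= c ->
  (forall x, a <= x <= b -> is_derive x 1 f (df x)) ->
  (forall x, a <= x <= b -> f x <= f a -> df x < - c) ->
  f b <= f a - c * (b - a).
Proof.
move=> ab c0 fD H.
have := @pushed_up (- f) (fun x => - df x) a b c ab c0.
rewrite !fctE => K.
suff : - f a + c * (b - a) <= - f b by lra.
apply: K => [x xab|x xab]; first by have := fD x xab => ?; exact: is_deriveN.
by rewrite lerN2 ltrNr; apply: H.
Qed.

Lemma last_zero f a b : (forall x, a <= x <= b -> {for x, continuous f}) ->
  a <= b -> f a <= 0 -> 0 < f b ->
  exists z, [/\ a <= z < b, f z = 0 & forall x, z < x <= b -> 0 < f x].
Proof.
move=> fc ab fa fb.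
pose S : set R := [set x | a <= x <= b /\ f x <= 0].
have Sb : has_sup S.
  by split; [exists a; split; rewrite ?lexx|exists b => x [/andP[]]].
pose z := sup S.
have az : a <= z by apply: ub_le_sup; [exact: Sb.2|split]; rewrite ?lexx.
have zb : z <= b by apply: ge_sup => //; [exact: Sb.1|move=> x [/andP[]]].
have zpos x : z < x <= b -> 0 < f x.
  move=> /andP[zx xb]; rewrite ltNge; apply/negP => fx.
  have : x <= z by apply: ub_le_sup; [exact: Sb.2|split] => //; rewrite xb (le_trans az) // ltW.
  by rewrite leNgt zx.
have zc : {for z, continuous f} by apply: fc; rewrite az.
have fz : f z <= 0.
  rewrite leNgt; apply/negP => fz.
  have [r r0 rP] := continuous_dist zc fz.
  have [x [/andP[ax xb] fx] zx] := sup_adherent r0 Sb.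
  have xz : x <= z by apply: ub_le_sup; [exact: Sb.2|split] => //; rewrite ax.
  have : `|x - z| < r by rewrite distrC ger0_norm; rewrite -/z in zx; lra.
  by move=> /rP; rewrite ltr_norml => /andP[+ _]; lra.
have zb' : z < b.
  by rewrite lt_neqAle zb andbT; apply: contraTneq fb => <-; rewrite -leNgt.
exists z; split => //; first by rewrite az.
apply/eqP; rewrite eq_le fz /= leNgt; apply/negP => fz0.
have [|r r0 rP] := continuous_dist zc (e := - f z); first by rewrite oppr_gt0.
pose x := Num.min b (z + r / 2).
have zx : z < x by rewrite lt_min zb' ltrDl divr_gt0.
have xb : x <= b by rewrite ge_min lexx.
have xr : x <= z + r / 2 by rewrite ge_min lexx orbT.
have : `|x - z| < r by rewrite gtr0_norm; lra.
have : 0 < f x by apply: zpos; rewrite zx.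
by move=> ? /rP; rewrite ltr_norml => /andP[_]; lra.
Qed.

Lemma first_zero f a b : (forall x, a <= x <= b -> {for x, continuous f}) ->
  a <= b -> 0 < f a -> f b <= 0 ->
  exists z, [/\ a < z <= b, f z = 0 & forall x, a <= x < z -> 0 < f x].
Proof.
move=> fc ab fa fb.
have [||||z [zab fz zP]] := @last_zero (f \o -%R) (- b) (- a).
- move=> x xab; apply: continuous_comp; first exact: opp_continuous.
  by apply: fc; rewrite lerNr andbC lerNl.
- by rewrite lerN2.
- by rewrite /= opprK.
- by rewrite /= opprK.
exists (- z); split => //; first by rewrite ltrNr andbC lerNl.
by move=> x xz; have := zP (- x); rewrite /= opprK; apply; rewrite ltrNr lerN2 andbC.
Qed.

End Calculus.

(** * The Euler scheme and shooting *)

Section EulerScheme.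
Context {R : realType}.
Variables (eps kap : R).

(** The slope [p] of the logarithm [w] of a profile satisfies
    [p' = rate p (w (x - tau))]; the cap [kap] on the level, which solutions turn
    out not to reach, bounds the effect of the delay. *)
Definition rate (p w : R) : R :=
  (p - eps * p ^+ 2 - 1 + expR (Num.min w kap)) / eps.

Variables (h w0 : R) (N : nat).

(** A state is the current slope with the buffer of past levels, the level [j]
    steps ago at index [j], so that a delay of [N] steps is a component of the
    state and continuity in the initial slope is an induction on time. *)
Definition euler_step (s : R * (nat -> R)) : R * (nat -> R) :=
  (s.1 + h * rate s.1 (s.2 N),
   fun j => if j is i.+1 then s.2 i else s.2 0%N + h * s.1).

Definition euler (r : R) (k : nat) := iter k euler_step (r, fun=> w0).
Definition slope r k := (euler r k).1.
Definition level r k := (euler r k).2 0%N.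

Lemma euler_buffer r k j : (euler r k).2 j = level r (k - j).
Proof.
elim: k j => [|k IH] [|j] //.
by rewrite subSS -IH.
Qed.

Lemma slopeS r k :
  slope r k.+1 = slope r k + h * rate (slope r k) (level r (k - N)).
Proof. by rewrite -euler_buffer. Qed.

Lemma continuous_rate (p w : R -> R) (x : R) :
  {for x, continuous p} -> {for x, continuous w} ->
  {for x, continuous (fun r => rate (p r) (w r))}.
Proof.
move=> pc wc; apply: cvgM; last exact: cvg_cst.
apply: cvgD.
  apply: cvgB; last exact: cvg_cst.
  apply: cvgB => //; apply: cvgM; first exact: cvg_cst.
  by apply: cvgM.
apply: continuous_comp; last exact: continuous_expR.
by apply: continuous_min => //; exact: cvg_cst.
Qed.

Lemma continuous_euler k : continuous (slope^~ k) /\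
  forall j, continuous (fun r => (euler r k).2 j).
Proof.
elim: k => [|k [IHs IHl]].
  by split=> [x|j x]; [exact: cvg_id|exact: cvg_cst].
split=> [x|[|j] x].
- apply: cvgD; first exact: IHs.
  apply: cvgM; first exact: cvg_cst.
  by apply: continuous_rate; [exact: IHs|exact: IHl].
- apply: cvgD; first exact: IHl.
  by apply: cvgM; [exact: cvg_cst|exact: IHs].
- exact: IHl.
Qed.

Variable Q : R.
Hypothesis eps0 : 0 < eps.
Hypothesis eps4 : eps <= 1 / 4.
Hypothesis h0 : 0 < h.
Hypothesis Q0 : 0 < Q.
Hypothesis QE : expR kap - 1 <= Q + eps * Q ^+ 2.

Let mu := (2 * eps)^-1.

Let mu_gt0 : 0 < mu.
Proof. by rewrite invr_gt0 mulr_gt0. Qed.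

Lemma rate_low w : rate (- Q) w <= 0.
Proof.
rewrite /rate ler_pdivrMr // mul0r.
have : expR (Num.min w kap) <= expR kap by rewrite ler_expR ge_min lexx orbT.
have := QE; rewrite sqrrN; lra.
Qed.

(** The equation without the delayed term has slope [(p - eps p^2 - 1) / eps],
    whose maximum, at [p = mu], is nonnegative exactly if [eps <= 1 / 4]: this is
    the condition [c >= 2] on the speed. *)
Lemma rate_high w : 0 <= rate mu w.
Proof.
rewrite /rate ler_pdivlMr // mul0r.
have := expR_gt0 (Num.min w kap).
have -> : mu - eps * mu ^+ 2 = (4 * eps)^-1.
  by rewrite /mu; field; rewrite gt_eqF.
have : 1 <= (4 * eps)^-1 by have := eps0; have := eps4 => *; rewrite invf_ge1; lra.
lra.
Qed.

(** The initial slopes for which the first [k] slopes stay in [[-Q, mu]] include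
    an interval on whose ends the last slope takes the values [-Q] and [mu];
    these thresholds can only be crossed outwards, and continuity does the
    rest. *)
Lemma shooting_interval k : exists a b,
  [/\ a <= b, slope a k = - Q, slope b k = mu &
   forall r i, a <= r <= b -> (i <= k)%N -> - Q <= slope r i <= mu].
Proof.
elim: k => [|k [a [b [ab ak bk IH]]]].
  have := mu_gt0; have := Q0 => *.
  exists (- Q), mu; split => //; first lra.
  by move=> r [].
have mu0 := mu_gt0; have Q0' := Q0.
pose f r := slope r k.+1.
have fc (x : R) : {for x, continuous f} by have [+ _] := continuous_euler k.+1; apply.
have fa : f a <= - Q.
  by rewrite /f slopeS ak gerDl pmulr_rle0 // rate_low.
have fb : mu <= f b.
  by rewrite /f slopeS bk lerDl pmulr_rge0 // rate_high.
have [||||b' [/andP[ab' b'b] fb' b'P]] := @first_zero R (fun r => mu - f r) a b.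
- by move=> x _; apply: cvgB; [exact: cvg_cst|exact: fc].
- exact: ab.
- lra.
- lra.
have [||||a' [/andP[aa' a'b'] fa' a'P]] := @last_zero R (fun r => f r + Q) a b'.
- by move=> x _; apply: cvgD; [exact: fc|exact: cvg_cst].
- exact: ltW.
- lra.
- lra.
exists a', b'; split; [exact: ltW|rewrite -/(f a'); lra|rewrite -/(f b'); lra|].
move=> r i /andP[a'r rb']; rewrite leq_eqVlt ltnS => /orP[/eqP->|ik]; last first.
  by apply: IH => //; rewrite (le_trans aa') //= (le_trans rb').
rewrite -/(f r); move: a'r rb'.
rewrite !le_eqVlt => /orP[/eqP<-|a'r] /orP[/eqP rb'|rb'].
- by apply/andP; split; rewrite -le_eqVlt; lra.
- by apply/andP; split; rewrite -le_eqVlt; lra.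
- by rewrite rb'; apply/andP; split; rewrite -le_eqVlt; lra.
- have := a'P r; have := b'P r.
  rewrite a'r (ltW rb') rb' (le_trans aa' (ltW a'r)) => /(_ isT) ? /(_ isT) ?.
  by apply/andP; split; rewrite -le_eqVlt; lra.
Qed.

Lemma shooting k : exists r, forall i, (i <= k)%N -> - Q <= slope r i <= mu.
Proof.
have [a [b [ab _ _ H]]] := shooting_interval k.
by exists a => i; apply: H; rewrite lexx.
Qed.

End EulerScheme.

(** * Uniform estimates for the scheme *)

Section EulerEstimates.
Context {R : realType}.

Lemma expRN1_le_half : expR (- 1) <= 1 / 2 :> R.
Proof.
have e2 := expR_ge1Dx (1 : R).
by rewrite expRN -[1/2]invf_div divr1 lef_pV2 ?posrE ?expR_gt0 //.
Qed.

Lemma expR_capped_lipschitz (kap v w : R) :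
  `|expR (Num.min v kap) - expR (Num.min w kap)| <= expR kap * `|v - w|.
Proof.
wlog vw : v w / v <= w.
  move=> H; have [vw|/ltW wv] := leP v w; first exact: H.
  by rewrite distrC (distrC v); exact: H.
have [m1 m2] : Num.min v kap <= Num.min w kap /\
    Num.min w kap - Num.min v kap <= w - v.
  by case: (leP v kap); case: (leP w kap) => *; split; lra.
have mk : Num.min w kap <= kap by rewrite ge_min lexx orbT.
rewrite distrC (distrC v) !ger0_norm ?subr_ge0 ?ler_expR //.
have := @increment_le R expR expR _ _ m1 (fun x _ => is_derive_expR x) (expR kap).
move=> /(_ _)/le_trans; apply.
  by move=> x /andP[_ xm]; rewrite ler_expR (le_trans xm).
by rewrite ler_wpM2l // expR_ge0.
Qed.

Lemma rate_bound (eps kap L p w : R) : 0 < eps -> `|p| <= L ->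
  `|rate eps kap p w| <= (L + eps * L ^+ 2 + 1 + expR kap) / eps.
Proof.
move=> e0 pL.
rewrite /rate normrM normfV (gtr0_norm e0) ler_pM2r ?invr_gt0 //.
have m1 : expR (Num.min w kap) <= expR kap by rewrite ler_expR ge_min lexx orbT.
have m0 := expR_gt0 (Num.min w kap).
have p2 : p ^+ 2 <= L ^+ 2 by move: pL; rewrite ler_norml => /andP[? ?]; nra.
move: pL; rewrite !ler_norml => /andP[? ?].
have : 0 <= p ^+ 2 by rewrite sqr_ge0.
by move=> ?; apply/andP; split; nra.
Qed.

Lemma rate_lipschitz (eps kap L p q v w : R) : 0 < eps ->
  `|p| <= L -> `|q| <= L ->
  `|rate eps kap p v - rate eps kap q w| <=
    ((1 + 2 * eps * L) * `|p - q| + expR kap * `|v - w|) / eps.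
Proof.
move=> e0 pL qL.
rewrite /rate -mulrBl normrM normfV (gtr0_norm e0) ler_pM2r ?invr_gt0 //.
have -> : p - eps * p ^+ 2 - 1 + expR (Num.min v kap) -
    (q - eps * q ^+ 2 - 1 + expR (Num.min w kap)) =
  (p - q) * (1 - eps * (p + q)) +
    (expR (Num.min v kap) - expR (Num.min w kap)) by ring.
apply: le_trans (ler_normD _ _) _; apply: lerD; last exact: expR_capped_lipschitz.
rewrite normrM mulrC ler_wpM2r //.
move: pL qL; rewrite !ler_norml => /andP[? ?] /andP[? ?].
by apply/andP; split; nra.
Qed.

Lemma sum_bound (h L : R) (K : nat) (a b : nat -> R) : 0 <= h ->
  (forall j, (j < K)%N -> a j.+1 = a j + h * b j) ->
  (forall j, (j < K)%N -> `|b j| <= L) ->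
  forall k i, (k + i <= K)%N -> `|a (k + i)%N - a k| <= L * (i%:R * h).
Proof.
move=> h0 aS bL k; elim=> [|i IH] kiK; first by rewrite addn0 subrr normr0 mul0r mulr0.
rewrite addnS in kiK *.
rewrite aS // -natr1 mulrDl mul1r mulrDr addrAC.
apply: le_trans (ler_normD _ _) _; apply: lerD; first by apply: IH; exact: ltnW.
by rewrite normrM ger0_norm // mulrC ler_wpM2r // bL.
Qed.

(** The second-order error of a discrete primitive, uniformly in the step [h]:
    the bound on increments of [b] plays the part of a Lipschitz constant. *)
Lemma sum_taylor (h B : R) (K : nat) (a b : nat -> R) k : 0 <= h -> 0 <= B ->
  (forall j, (j < K)%N -> a j.+1 = a j + h * b j) ->
  (forall i, (k + i < K)%N -> `|b (k + i)%N - b k| <= B * (i%:R * h)) ->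
  forall i, (k + i <= K)%N ->
    `|a (k + i)%N - a k - i%:R * h * b k| <= B * (i%:R * h) ^+ 2.
Proof.
move=> h0 B0 aS bB; elim=> [|i IH] kiK.
  by rewrite addn0 subrr mul0r !mul0r subr0 normr0 expr0n mulr0.
rewrite addnS in kiK *.
have E : a (k + i).+1 - a k - i.+1%:R * h * b k =
  (a (k + i)%N - a k - i%:R * h * b k) + h * (b (k + i)%N - b k).
  by rewrite aS // -natr1; ring.
rewrite E.
apply: le_trans (ler_normD _ _) _.
rewrite normrM (ger0_norm h0) -natr1.
have := IH (ltnW kiK); have := bB i kiK.
set u := `|_|; set v := `|_|; have i0 : 0 <= i%:R :> R by [].
move=> uB vB.
have ? : h * u <= h * (B * (i%:R * h)) by rewrite ler_wpM2l.
have ? : 0 <= B * h ^+ 2 * (i%:R + 1).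
  by rewrite !mulr_ge0 // ?sqr_ge0 //; lra.
nra.
Qed.

End EulerEstimates.

(** * Approximate entire solutions *)

Section ApproximateSolutions.
Context {R : realType}.

Lemma rate_below (eps kap p w : R) : 0 < eps -> w <= -1 -> p <= 1 / 4 ->
  rate eps kap p w <= - (4 * eps)^-1.
Proof.
move=> e0 wm1 p4.
have -> : - (4 * eps)^-1 = (- (1 / 4)) / eps.
  by field; rewrite gt_eqF.
rewrite /rate ler_pM2r ?invr_gt0 //.
have : expR (Num.min w kap) <= expR (- 1) by rewrite ler_expR ge_min wm1.
have := @expRN1_le_half R.
have : 0 <= eps * p ^+ 2 by rewrite mulr_ge0 ?sqr_ge0 // ltW.
lra.
Qed.

(** Below level [-1] slopes less than [1/4] would drop out of the admissible
    range, so the orbit keeps climbing. *)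
Lemma reach_level (eps kap h Q : R) (N K0 K1 : nat) (w p : nat -> R) :
  0 < eps -> 0 < h ->
  (forall j, w j.+1 = w j + h * p j) ->
  (forall j, p j.+1 = p j + h * rate eps kap (p j) (w (j - N)%N)) ->
  (forall j, (j <= K0 + K1)%N -> - Q <= p j) ->
  1 / 4 + Q < K0%:R * h / (4 * eps) -> - 4 * w 0%N <= K1%:R * h ->
  exists2 k, (k <= K0 + K1)%N & - 1 <= w k.
Proof.
move=> e0 h0 wS pS pQ K0P K1P; apply: contrapT => H.
have wm1 k : (k <= K0 + K1)%N -> w k <= - 1.
  by move=> kK; rewrite leNgt; apply/negP => wk; apply: H; exists k => //; exact: ltW.
have p4 k : (k <= K1)%N -> 1 / 4 <= p k.
  move=> kK; rewrite leNgt; apply/negP => pk.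
  have drop i : (i <= K0)%N -> p (k + i)%N <= 1 / 4 - i%:R * h / (4 * eps).
    elim: i => [|i IH] iK; first by rewrite addn0 !mul0r; lra.
    have {}IH := IH (ltnW iK).
    rewrite addnS pS -[i.+1%:R]natr1.
    have i0 : 0 <= i%:R * h / (4 * eps).
      by nonneg.
    have := @rate_below eps kap (p (k + i)%N) (w (k + i - N)%N) e0.
    move=> /(_ _ _)/(ler_wpM2l (ltW h0)) => rb.
    have {rb} : h * rate eps kap (p (k + i)%N) (w (k + i - N)%N) <= h * - (4 * eps)^-1.
      apply: rb; last lra.
      by apply: wm1; rewrite (leq_trans (leq_subr _ _)) // addnC leq_add // ltnW.
    lra.
  have := drop K0 (leqnn _); have := pQ (k + K0)%N.
  by rewrite addnC leq_add2l kK => /(_ isT); lra.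
have climb i : (i <= K1)%N -> w 0%N + i%:R * h / 4 <= w i.
  elim: i => [|i IH] iK; first by rewrite !mul0r addr0.
  rewrite wS -[i.+1%:R]natr1; have := IH (ltnW iK).
  have := ler_wpM2l (ltW h0) (p4 _ (ltnW iK)); lra.
have := climb K1 (leqnn _); have := wm1 K1; rewrite leq_addl => /(_ isT).
lra.
Qed.

Lemma grid_index (h s x : R) : 0 < h -> 0 <= x + s ->
  (Num.truncn ((x + s) / h))%:R * h <= x + s < ((Num.truncn ((x + s) / h))%:R + 1) * h.
Proof.
move=> h0 xs.
have /truncn_itv : 0 <= (x + s) / h by rewrite divr_ge0 // ltW.
by rewrite ler_pdivlMr // ltr_pdivrMr // natr1.
Qed.

Lemma shifted_gap (a j N : nat) : (a + j - N - (a - N) <= j)%N.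
Proof. lia. Qed.

Lemma natr_exceeds (x : R) : exists n : nat, x < n%:R.
Proof. by exists (Num.truncn x).+1; exact: truncnS_gt. Qed.

(** Step functions through the points of a shooting orbit with step
    [1 / (n + 1)], with time shifted so that level [-1] is first reached at time
    [0], are approximate solutions on the interval [[-n, n]]. The orbit starts
    so low that even with slope [mu] it needs longer than [n] to reach [-1]. All
    errors have the form [B * (d ^+ 2 + (1 + d) / (n + 1))] for a time lapse
    [d], with [B] independent of [n]. *)
Lemma approximate_solution (eps tau kap Q : R) :
  0 < eps -> eps <= 1 / 4 -> 0 <= tau -> 0 < Q ->
  expR kap - 1 <= Q + eps * Q ^+ 2 ->
  exists2 B : R, 0 <= B & forall n : nat, exists W P : R -> R,
    [/\ forall x, - n%:R <= x <= n%:R -> - Q <= P x <= (2 * eps)^-1,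
        forall x y, - n%:R <= x <= y -> y <= n%:R ->
          `|W y - W x - (y - x) * P x| <=
             B * ((y - x) ^+ 2 + (1 + (y - x)) / n.+1%:R),
        forall x y, - n%:R <= x - tau -> x <= y <= n%:R ->
          `|P y - P x - (y - x) * rate eps kap (P x) (W (x - tau))| <=
             B * ((y - x) ^+ 2 + (1 + (y - x)) / n.+1%:R),
        - 1 <= W 0 <= - 1 + B / n.+1%:R
      & forall x, - n%:R <= x < 0 -> W x <= - 1].
Proof.
move=> e0 e4 tau0 Q0 QE.
set mu := (2 * eps)^-1.
have mu0 : 0 < mu by rewrite invr_gt0 mulr_gt0.
(* [L] and [A] bound the slope and its rate, [C] is a Lipschitz constant of the
   rate along the orbit, and [D] accounts for rounding the delay to a multiple
   of the step. *)
pose L := Q + mu.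
pose A := (L + eps * L ^+ 2 + 1 + expR kap) / eps.
pose C := ((1 + 2 * eps * L) * A + expR kap * L) / eps.
pose D := expR kap * (2 * L) / eps.
have L0 : 0 < L by rewrite addr_gt0.
have ek := expR_gt0 kap.
have A0 : 0 <= A.
  by nonneg.
have C0 : 0 <= C.
  by nonneg.
have D0 : 0 <= D by nonneg.
pose B := 2 * A + L + 2 * C + D + mu.
have B0 : 0 <= B by rewrite /B; lra.
have [BA BC BD Bmu] : [/\ 2 * A + L <= B, 2 * C + A <= B, D <= B & mu <= B].
  by rewrite /B; split; lra.
exists B => // n.
pose h : R := n.+1%:R^-1.
have h0 : 0 < h by rewrite invr_gt0.
have h1 : h <= 1 by rewrite invf_le1 ?ler1n.
pose N := Num.truncn (tau / h).
have Nb : N%:R * h <= tau < (N%:R + 1) * h.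
  by have := @grid_index h 0 tau h0; rewrite !addr0 => /(_ tau0).
pose w0 := - 1 - n%:R * mu - mu.
have [K0 K0P] := natr_exceeds ((1 / 4 + Q) / (h / (4 * eps))).
have [K1 K1P] := natr_exceeds (- 4 * w0 / h).
have [K2 K2P] := natr_exceeds (n%:R / h).
pose K := (K0 + K1 + K2)%N.
have [r rP] := @shooting R eps kap h w0 N Q e0 e4 h0 Q0 QE K.
set p := slope eps kap h w0 N r in rP.
pose w := level eps kap h w0 N r.
have wS j : w j.+1 = w j + h * p j by [].
have pS j : p j.+1 = p j + h * rate eps kap (p j) (w (j - N)%N) by exact: slopeS.
have pL j : (j <= K)%N -> `|p j| <= L.
  move=> /rP; rewrite -/mu => /andP[? ?].
  by rewrite ler_norml /L; apply/andP; split; lra.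
have reach : exists k, (k <= K0 + K1)%N && (- 1 <= w k).
  have [|||k k1 k2] := @reach_level eps kap h Q N K0 K1 w p e0 h0 wS pS.
  - by move=> j jK; have /andP[] := rP j (leq_trans jK (leq_addr _ _)).
  - by move: K0P; rewrite ltr_pdivrMr ?mulrA // divr_gt0 // mulr_gt0.
  - by move: K1P; rewrite ltr_pdivrMr // => /ltW.
  - by exists k; rewrite k1.
pose k := ex_minn reach.
have [kK wk kmin] : [/\ (k <= K0 + K1)%N, - 1 <= w k &
    forall j, (j < k)%N -> w j < - 1].
  rewrite /k; case: ex_minnP => m /andP[mK wm] mP; split => // j jm.
  rewrite ltNge; apply/negP => wj; have := mP j.
  by rewrite wj (leq_trans (ltnW jm) mK) /= leqNgt jm => /(_ isT).
have w_le j : (j <= K)%N -> w j <= w0 + j%:R * h * mu.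
  elim: j => [|j IH] jK; first by rewrite !mul0r addr0.
  rewrite wS -natr1; have := IH (ltnW jK).
  have /andP[_ pj] := rP _ (ltnW jK).
  have := ler_wpM2l (ltW h0) pj; rewrite -/mu; lra.
have kK' : (k <= K)%N by rewrite (leq_trans kK) // leq_addr.
pose s := k%:R * h.
have sn : n%:R + 1 <= s.
  have := le_trans wk (w_le _ kK'); rewrite -/s /w0 => H.
  have : 0 <= (s - (n%:R + 1)) * mu by lra.
  by rewrite pmulr_lge0 // subr_ge0.
have kpos : (0 < k)%N.
  rewrite lt0n; apply/negP => /eqP k0; move: sn; rewrite /s k0 mul0r => sn.
  have : 0 <= n%:R :> R by []. lra.
pose idx x := Num.truncn ((x + s) / h).
have idxP x : - n%:R <= x -> (idx x)%:R * h <= x + s < ((idx x)%:R + 1) * h.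
  by move=> xn; apply: grid_index => //; lra.
have idx_le x y : x <= y -> (idx x <= idx y)%N.
  by move=> xy; apply: le_truncn; rewrite ler_pM2r ?invr_gt0 // lerD2r.
have idxK x : x <= n%:R -> (idx x <= K)%N.
  move=> xn; rewrite /idx -ltnS.
  have [xs|xs] := ltP (x + s) 0.
    rewrite (_ : Num.truncn _ = 0%N) //.
    by apply/eqP; rewrite -leqn0 truncn_le_nat ltr_pdivrMr // mul1r; lra.
  rewrite truncn_lt_nat ?divr_ge0 // 1?ltW //.
  rewrite ltr_pdivrMr // -natr1 /K natrD.
  have : k%:R <= (K0 + K1)%:R :> R by rewrite ler_nat.
  move=> /(ler_wpM2r (ltW h0)); rewrite -/s.
  by move: K2P; rewrite ltr_pdivrMr //; lra.
have pA j : (j < K)%N -> `|rate eps kap (p j) (w (j - N)%N)| <= A.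
  by move=> jK; apply: rate_bound => //; apply: pL; exact: ltnW.
have dw := sum_bound (ltW h0) (fun j _ => wS j) (fun j jK => pL j (ltnW jK)).
have dp := sum_bound (ltW h0) (fun j _ => pS j) pA.
have dw' i j : (i <= j)%N -> (j <= K)%N -> `|w j - w i| <= L * ((j - i)%:R * h).
  by move=> ij jK; have := dw i (j - i)%N; rewrite subnKC // => /(_ jK).
have gap x y : - n%:R <= x -> x <= y ->
    exists i : nat, [/\ idx y = (idx x + i)%N, i%:R * h <= (y - x) + h &
      `|i%:R * h - (y - x)| <= h].
  move=> nx xy; exists (idx y - idx x)%N.
  have ij := idx_le _ _ xy.
  have /andP[? ?] := idxP x nx; have /andP[? ?] := idxP y (le_trans nx xy).
  rewrite subnKC // natrB // ler_norml; split => //; first by lra.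
  by apply/andP; split; lra.
have sq u d : 0 <= u -> 0 <= d -> u <= d + h -> u ^+ 2 <= 2 * d ^+ 2 + 2 * h.
  move=> u0 d0 ud.
  have ? : u ^+ 2 <= (d + h) ^+ 2 by rewrite ler_sqr ?nnegrE // addr_ge0 // ltW.
  have ? : 0 <= (d - h) ^+ 2 by rewrite sqr_ge0.
  have ? : h ^+ 2 <= h by rewrite expr2 ler_piMl // ltW.
  lra.
exists (w \o idx), (p \o idx); split.
- by move=> x /andP[_ xn]; apply: rP; exact: idxK.
- move=> x y /andP[nx xy] yn /=.
  have [i [iE ih ihd]] := gap x y nx xy.
  have yK := idxK _ yn.
  rewrite iE in yK *.
  have T : `|w (idx x + i)%N - w (idx x) - i%:R * h * p (idx x)| <= A * (i%:R * h) ^+ 2.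
    apply: (sum_taylor (ltW h0) A0 (fun j _ => wS j)) yK => j jK.
    by apply: dp; exact: ltnW.
  have d0 : 0 <= y - x by rewrite subr_ge0.
  have i0 : 0 <= i%:R * h by rewrite mulr_ge0 // ltW.
  have S := sq _ _ i0 d0 ih.
  have E : w (idx x + i)%N - w (idx x) - (y - x) * p (idx x) =
    (w (idx x + i)%N - w (idx x) - i%:R * h * p (idx x)) +
    (i%:R * h - (y - x)) * p (idx x) by ring.
  rewrite E; apply: le_trans (ler_normD _ _) _.
  have T2 : `|(i%:R * h - (y - x)) * p (idx x)| <= h * L.
    rewrite normrM ler_pM // pL //; exact: leq_trans (leq_addr _ _) yK.
  apply: le_trans (lerD T T2) _.
  have ? := ler_wpM2l A0 S; rewrite -/h.
  have ? : 0 <= h * (y - x) by rewrite mulr_ge0 // ltW.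
  have d2 : 0 <= (y - x) ^+ 2 by rewrite sqr_ge0.
  have : 0 <= (B - (2 * A + L)) * ((y - x) ^+ 2 + h) + L * (y - x) ^+ 2 + B * (h * (y - x)).
    by nonneg.
  lra.
- move=> x y nxt /andP[xy yn] /=.
  have nx : - n%:R <= x by lra.
  have [i [iE ih ihd]] := gap x y nx xy.
  have yK := idxK _ yn.
  have xK := idxK _ (le_trans xy yn).
  rewrite iE in yK *.
  set f := fun j => rate eps kap (p j) (w (j - N)%N).
  have T : `|p (idx x + i)%N - p (idx x) - i%:R * h * f (idx x)| <= C * (i%:R * h) ^+ 2.
    apply: (sum_taylor (ltW h0) C0 (fun j _ => pS j)) yK => j jK.
    have jK' := ltnW jK.
    apply: le_trans (rate_lipschitz _ _ _ e0 (pL _ jK') (pL _ xK)) _.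
    rewrite /C [leRHS]mulrAC ler_pM2r ?invr_gt0 // [leRHS]mulrDl.
    apply: lerD.
      rewrite -[leRHS]mulrA ler_wpM2l //; [by nonneg|exact: dp].
    rewrite -[leRHS]mulrA (ler_wpM2l (ltW ek)) //.
    have le1 : (idx x - N <= idx x + j - N)%N by rewrite leq_sub2r // leq_addr.
    apply: le_trans (dw' _ _ le1 _) _.
      by rewrite (leq_trans (leq_subr _ _)).
    by rewrite (ler_wpM2l (ltW L0)) // (ler_wpM2r (ltW h0)) // ler_nat shifted_gap.
  have lag : `|f (idx x) - rate eps kap (p (idx x)) (w (idx (x - tau)))| <= D * h.
    apply: le_trans (rate_lipschitz _ _ _ e0 (pL _ xK) (pL _ xK)) _.
    rewrite subrr normr0 mulr0 add0r /D [leRHS]mulrAC ler_pM2r ?invr_gt0 // -mulrA.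
    rewrite (ler_wpM2l (ltW ek)) //.
    have /andP[a1 a2] := idxP x nx; have /andP[b1 b2] := idxP (x - tau) nxt.
    case/andP: Nb => N1 N2.
    set m := idx (x - tau) in b1 b2 *.
    have Nx : (N + m <= idx x)%N.
      rewrite -ltnS -(ltr_nat R) -natr1 natrD.
      by rewrite -(ltr_pM2r h0); lra.
    have Nx' : (idx x <= N + m + 1)%N.
      rewrite -ltnS -(ltr_nat R) -addn1 !natrD.
      by rewrite -(ltr_pM2r h0); lra.
    have ba : (m <= idx x - N)%N.
      by rewrite leq_subRL // (leq_trans (leq_addr _ _) Nx).
    have aK : (idx x - N <= K)%N by rewrite (leq_trans (leq_subr _ _)).
    apply: le_trans (dw' _ _ ba aK) _.
    rewrite [2 * L]mulrC -mulrA (ler_wpM2l (ltW L0)) // (ler_wpM2r (ltW h0)) //.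
    by rewrite ler_nat leq_subLR leq_subLR (leq_trans Nx') // -addnA leq_add2l leq_add2l.
  have d0 : 0 <= y - x by rewrite subr_ge0.
  have i0 : 0 <= i%:R * h by rewrite mulr_ge0 // ltW.
  have S := sq _ _ i0 d0 ih.
  have fA : `|f (idx x)| <= A by apply: rate_bound => //; exact: pL.
  have E : p (idx x + i)%N - p (idx x) - (y - x) * rate eps kap (p (idx x)) (w (idx (x - tau))) =
    (p (idx x + i)%N - p (idx x) - i%:R * h * f (idx x)) +
    ((i%:R * h - (y - x)) * f (idx x) +
     (y - x) * (f (idx x) - rate eps kap (p (idx x)) (w (idx (x - tau))))) by ring.
  rewrite E; apply: le_trans (ler_normD _ _) _.
  have T2 : `|(i%:R * h - (y - x)) * f (idx x)| <= h * A by rewrite normrM ler_pM.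
  have T3 : `|(y - x) * (f (idx x) - rate eps kap (p (idx x)) (w (idx (x - tau))))|
      <= (y - x) * (D * h) by rewrite normrM (ger0_norm d0) ler_wpM2l.
  apply: le_trans (lerD T (le_trans (ler_normD _ _) (lerD T2 T3))) _.
  have ? := ler_wpM2l C0 S; rewrite -/h.
  have d2 : 0 <= (y - x) ^+ 2 by rewrite sqr_ge0.
  have h0' := ltW h0.
  have : 0 <= (B - (2 * C + A)) * ((y - x) ^+ 2 + h) + A * (y - x) ^+ 2 +
     (B - D) * (h * (y - x)) by nonneg.
  lra.
- have -> : (w \o idx) 0 = w k by rewrite /= /idx add0r mulfK ?natrK // gt_eqF.
  rewrite wk /=.
  move: (kpos) (kmin k.-1); case: (k) kK' => // j jK _ /(_ (leqnn _)) /= wj.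
  rewrite wS; have /andP[_ pj] := rP _ (ltnW jK).
  have := ler_wpM2l (ltW h0) pj; rewrite -/mu -/h.
  have := ler_wpM2r (ltW h0) Bmu.
  lra.
- move=> x /andP[nx x0] /=; apply/ltW/kmin.
  have /andP[ix _] := idxP x nx.
  rewrite -(ltr_nat R) -(ltr_pM2r h0) -/s; lra.
Qed.

End ApproximateSolutions.

(** * Passage to the limit *)

Section UltrafilterLimits.
Context {R : realType} (U : set_system nat) {UU : UltraFilter U}.

(** Along an ultrafilter every bounded sequence converges, so the approximate
    solutions converge at all points at once, without extraction of
    subsequences. *)
Lemma cvg_ultra_bounded (u : nat -> R) (M : R) :
  (\forall n \near U, `|u n| <= M) -> exists l : R, u n @[n --> U] --> l.
Proof.
move=> uM.
have UuM : (u @ U) (fun x : R => x \in `[- M, M]).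
  by apply: filterS uM => n /=; rewrite in_itv /= ler_norml.
have [l [_ cl]] := @segment_compact R (- M) M (u @ U) _ UuM.
exists l => A lA.
have [//|UA] := in_ultra_setVsetC (u @^-1` A) UU.
by have [x [nAx Ax]] := cl _ _ (UA : (u @ U) (~` A)) lA.
Qed.

Lemma cvg_rate (eps kap : R) (p w : nat -> R) (p0 w0 : R) :
  p n @[n --> U] --> p0 -> w n @[n --> U] --> w0 ->
  rate eps kap (p n) (w n) @[n --> U] --> rate eps kap p0 w0.
Proof.
move=> cp cw; apply: cvgM; last exact: cvg_cst.
apply: cvgD.
  apply: cvgB; last exact: cvg_cst.
  apply: cvgB => //; apply: cvgM; first exact: cvg_cst.
  by apply: cvgM.
have h_cont : {for w0, continuous (fun x : R => expR (Num.min x kap))}.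
  apply: continuous_comp; last exact: continuous_expR.
  by apply: continuous_min; [exact: cvg_id|exact: cvg_cst].
exact: continuous_cvg h_cont cw.
Qed.

End UltrafilterLimits.

Section EntireSolution.
Context {R : realType}.

(** A one-sided quadratic Taylor estimate suffices when the candidate for the
    derivative is Lipschitz. *)
Lemma is_derive_of_forward_bound (f d : R -> R) (B C x : R) :
  (forall x y : R, x <= y <= x + 1 ->
    `|f y - f x - (y - x) * d x| <= B * (y - x) ^+ 2) ->
  (forall x y : R, x <= y <= x + 1 -> `|d y - d x| <= C * (y - x)) ->
  is_derive x 1 f (d x).
Proof.
move=> fB dC.
have C0 : 0 <= C.
  have := dC x (x + 1); rewrite lexx lerDl ler01 => /(_ isT).
  have -> : x + 1 - x = 1 by ring.
  by rewrite mulr1; exact: le_trans (normr_ge0 _).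
apply: (is_derive_of_bound (K := B + C)) => y.
have [xy|yx] := leP x y.
  rewrite ger0_norm ?subr_ge0 // => y1.
  have xyx : x <= y <= x + 1 by rewrite xy /=; lra.
  have := fB _ _ xyx; rewrite [d x * _]mulrC => /le_trans; apply.
  have : 0 <= C * (y - x) ^+ 2 by nonneg.
  lra.
rewrite ltr0_norm ?subr_lt0 // => y1.
have yxy : y <= x <= y + 1 by rewrite ltW //=; lra.
have E : f y - f x - d x * (y - x) =
  - (f x - f y - (x - y) * d y) + (d x - d y) * (x - y) by ring.
rewrite E; apply: le_trans (ler_normD _ _) _.
have xy0 : 0 <= x - y by rewrite subr_ge0 ltW.
rewrite normrN normrM (ger0_norm xy0).
have := ler_wpM2r xy0 (dC _ _ yxy); have := fB _ _ yxy.
have -> : (y - x) ^+ 2 = (x - y) ^+ 2 by ring.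
lra.
Qed.

(** The limit inherits the Taylor estimates of the approximate solutions without
    the terms in [1 / (n + 1)]; these estimates also give the Lipschitz bounds
    that turn one-sided estimates into derivatives. *)
Lemma entire_solution (eps tau kap Q : R) :
  0 < eps -> eps <= 1 / 4 -> 0 <= tau -> 0 < Q ->
  expR kap - 1 <= Q + eps * Q ^+ 2 ->
  exists w p : R -> R,
    [/\ forall x, is_derive (x : R) 1 w (p x),
        forall x, is_derive (x : R) 1 p (rate eps kap (p x) (w (x - tau))),
        forall x, - Q <= p x <= (2 * eps)^-1,
        w 0 = - 1 & forall x, x <= 0 -> w x <= - 1].
Proof.
move=> e0 e4 tau0 Q0 QE.
have [B B0 /choice[W /choice[P WP]]] := approximate_solution e0 e4 tau0 Q0 QE.
set mu := (2 * eps)^-1 in WP *.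
have mu0 : 0 < mu by rewrite invr_gt0 mulr_gt0.
have [U [UU oU]] := ultraFilterLemma eventually_filter.
have inU (S : set nat) : (\forall n \near \oo, S n) -> (\forall n \near U, S n).
  exact: oU.
have window (x : R) : \forall n \near U, - n%:R <= x <= n%:R.
  apply: inU; have [k /ltW xk] := natr_exceeds `|x|.
  exists k => // n /= kn; rewrite -ler_norml (le_trans xk) // ler_nat //.
pose L := Q + mu.
have PL (x : R) : \forall n \near U, - Q <= P n x <= mu.
  apply: filterS (window x) => n nx.
  by have [H _ _ _ _] := WP n; exact: H.
have WTaylor (x y : R) : x <= y -> \forall n \near U,
    `|W n y - W n x - (y - x) * P n x| <=
             B * ((y - x) ^+ 2 + (1 + (y - x)) / n.+1%:R).
  move=> xy; apply: filterS2 (window x) (window y) => n /andP[nx _] /andP[_ yn].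
  by have [_ H _ _ _] := WP n; apply: H; rewrite ?nx.
have PTaylor (x y : R) : x <= y -> \forall n \near U,
    `|P n y - P n x - (y - x) * rate eps kap (P n x) (W n (x - tau))| <=
             B * ((y - x) ^+ 2 + (1 + (y - x)) / n.+1%:R).
  move=> xy; apply: filterS2 (window (x - tau)) (window y) => n /andP[nx _] /andP[_ yn].
  by have [_ _ H _ _] := WP n; apply: H; rewrite ?xy.
have inv1 n : (0 <= n.+1%:R^-1 :> R) && (n.+1%:R^-1 <= 1 :> R) by rewrite invr_ge0 ler0n invf_le1 ?ler1n.
have W0 : \forall n \near U, - 1 <= W n 0 <= - 1 + B / n.+1%:R.
  by apply: filterE => n; have [_ _ _ H _] := WP n.
have Wbnd (x : R) : exists M, \forall n \near U, `|W n x| <= M.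
  exists (1 + B + (`|x| * L + B * (x ^+ 2 + 1 + `|x|))).
  have key (a b : R) : a <= b -> b - a = `|x| -> \forall n \near U,
      `|W n b - W n a| <= `|x| * L + B * (x ^+ 2 + 1 + `|x|).
    move=> ab bax; apply: filterS2 (WTaylor a b ab) (PL a) => n; rewrite bax => T /andP[? ?].
    have -> : W n b - W n a = (W n b - W n a - `|x| * P n a) + `|x| * P n a by ring.
    apply: le_trans (ler_normD _ _) _; rewrite addrC; apply: lerD.
      rewrite normrM normr_id ler_wpM2l // ler_norml /L.
      by apply/andP; split; lra.
    apply: le_trans T _; rewrite real_normK ?num_real // ler_wpM2l //.
    have /andP[_ i1] := inv1 n.
    by rewrite -[leRHS]addrA lerD2l ler_piMr // addr_ge0.
  have d0 : \forall n \near U, `|W n x - W n 0| <= `|x| * L + B * (x ^+ 2 + 1 + `|x|).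
    have [x0|x0] := leP 0 x.
      by apply: key => //; rewrite subr0 ger0_norm.
    have := key x 0 (ltW x0); rewrite sub0r ltr0_norm // => /(_ erefl).
    by apply: filterS => n; rewrite distrC.
  apply: filterS2 d0 W0 => n d /andP[w1 w2].
  have -> : W n x = W n 0 + (W n x - W n 0) by ring.
  apply: le_trans (ler_normD _ _) _; apply: lerD => //.
  have /andP[i0 i1] := inv1 n.
  have : B / n.+1%:R <= B by rewrite ler_piMr.
  have : 0 <= B / n.+1%:R by nonneg.
  move: w1 w2; move: (W n 0) (B / _) => u v.
  by move=> *; rewrite ler_norml; apply/andP; split; lra.
have /choice[w cw] (x : R) : exists l : R, W n x @[n --> U] --> l.
  by have [M] := Wbnd x; exact: cvg_ultra_bounded.
have /choice[p cp] (x : R) : exists l : R, P n x @[n --> U] --> l.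
  apply: (@cvg_ultra_bounded _ _ _ _ L).
  apply: filterS (PL x) => n /andP[? ?]; rewrite ler_norml /L.
  by apply/andP; split; lra.
have pQ (x : R) : - Q <= p x <= mu.
  apply/andP; split.
    by apply: cvgr_to_ge (cp x) _; apply: filterS (PL x) => n /andP[].
  by apply: cvgr_to_le (cp x) _; apply: filterS (PL x) => n /andP[].
have pL (x : R) : `|p x| <= L.
  have /andP[? ?] := pQ x.
  by rewrite ler_norml /L; apply/andP; split; lra.
have inv0 : n.+1%:R^-1 @[n --> U] --> (0 : R).
  move=> S /(cvg_harmonic (R := R)); exact: oU.
have err (x y : R) : B * ((y - x) ^+ 2 + (1 + (y - x)) / n.+1%:R) @[n --> U] -->
    B * (y - x) ^+ 2.
  rewrite -[X in _ --> B * X]addr0 -(mulr0 (1 + (y - x))).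
  apply: cvgM; first exact: cvg_cst.
  apply: cvgD; first exact: cvg_cst.
  by apply: cvgM => //; exact: cvg_cst.
pose r x := rate eps kap (p x) (w (x - tau)).
have wT (x y : R) : x <= y -> `|w y - w x - (y - x) * p x| <= B * (y - x) ^+ 2.
  move=> /WTaylor; apply: ler_cvg_to; last exact: err.
  apply: cvg_norm; apply: cvgB; first by apply: cvgB.
  by apply: cvgM => //; exact: cvg_cst.
have pT (x y : R) : x <= y -> `|p y - p x - (y - x) * r x| <= B * (y - x) ^+ 2.
  move=> /PTaylor; apply: ler_cvg_to; last exact: err.
  apply: cvg_norm; apply: cvgB; first by apply: cvgB.
  by apply: cvgM; [exact: cvg_cst|exact: cvg_rate].
have lip (f d : R -> R) (D : R) : (forall x, `|d x| <= D) ->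
    (forall x y, x <= y -> `|f y - f x - (y - x) * d x| <= B * (y - x) ^+ 2) ->
    forall x y, x <= y <= x + 1 -> `|f y - f x| <= (D + B) * (y - x).
  move=> dD fB x y /andP[xy yx].
  have -> : f y - f x = (f y - f x - (y - x) * d x) + (y - x) * d x by ring.
  apply: le_trans (ler_normD _ _) _; rewrite normrM.
  have d0 : 0 <= y - x by rewrite subr_ge0.
  rewrite (ger0_norm d0); have := ler_wpM2l d0 (dD x); have := fB _ _ xy.
  have : B * (y - x) ^+ 2 <= B * (y - x) by rewrite ler_wpM2l // expr2 ler_piMl //; lra.
  lra.
pose A := (L + eps * L ^+ 2 + 1 + expR kap) / eps.
have rA x : `|r x| <= A by apply: rate_bound.
have wlip := lip w p L pL wT.
have plip := lip p r A rA pT.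
have w0 : w 0 = - 1.
  apply/eqP; rewrite eq_le; apply/andP; split.
    have c1 : - 1 + B / n.+1%:R @[n --> U] --> (- 1 : R).
      rewrite -[X in _ --> X]addr0 -(mulr0 B).
      by apply: cvgD; [exact: cvg_cst|apply: cvgM => //; exact: cvg_cst].
    by apply: ler_cvg_to (cw 0) c1 _; apply: filterS W0 => n /andP[].
  by apply: cvgr_to_ge (cw 0) _; apply: filterS W0 => n /andP[].
exists w, p; split => //.
- move=> x; apply: is_derive_of_forward_bound plip => a b /andP[ab _].
  exact: wT.
- move=> x.
  pose C := ((1 + 2 * eps * L) * (A + B) + expR kap * (L + B)) / eps.
  apply: (@is_derive_of_forward_bound p r B C x) => a b /andP[ab ba]; first exact: pT.
  apply: le_trans (rate_lipschitz _ _ _ e0 (pL _) (pL _)) _.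
  rewrite /C [leRHS]mulrAC ler_pM2r ?invr_gt0 // [leRHS]mulrDl -!mulrA.
  apply: lerD.
    rewrite !mulrA -[leRHS]mulrA ler_wpM2l //; last by apply: plip; rewrite ab.
    by rewrite /L; nonneg.
  rewrite ler_wpM2l ?expR_ge0 //.
  have -> : b - a = (b - tau) - (a - tau) by ring.
  by apply: wlip; apply/andP; split; lra.
- move=> x; rewrite le_eqVlt => /orP[/eqP->|x0].
    by rewrite w0.
  apply: cvgr_to_le (cw x) _; apply: filterS (window x) => n /andP[nx _].
  by have [_ _ _ _ H] := WP n; apply: H; rewrite nx.
Qed.

End EntireSolution.

(** * Maxima and upper limits *)

Section Extrema.
Context {R : realType}.
Implicit Types (f df ddf : R -> R) (a b x : R).

Lemma mean_value_open f df a b : a < b ->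
  (forall x, a <= x <= b -> is_derive x 1 f (df x)) ->
  exists2 c, a < c < b & f b - f a = df c * (b - a).
Proof.
move=> ab fD; have [||c cab E] := @MVT R f df a b ab.
- by move=> x; rewrite in_itv /= => /andP[? ?]; apply: fD; rewrite !ltW.
- by apply: within_continuous => x /fD /is_derive_continuous.
by exists c; [move: cab; rewrite in_itv|].
Qed.

Lemma increases_right f x d : is_derive x 1 f d -> 0 < d ->
  exists2 r : R, 0 < r & forall y, x < y < x + r -> f x < f y.
Proof.
move=> fD d0; have d2 : 0 < d / 2 by rewrite divr_gt0.
have [r r0 rP] := is_derive_bound fD d2; exists r => // y /andP[xy yr].
have : `|y - x| < r by rewrite gtr0_norm; lra.
move=> /rP; rewrite (gtr0_norm (x := y - x)) ?subr_gt0 // ler_norml => /andP[+ _].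
by nra.
Qed.

Lemma decreases_right f x d : is_derive x 1 f d -> d < 0 ->
  exists2 r : R, 0 < r & forall y, x < y < x + r -> f y < f x.
Proof.
move=> fD d0; have [|r r0 rP] := @increases_right (- f) x (- d) _ _.
- by rewrite oppr_gt0.
by exists r => // y /rP; rewrite !fctE ltrN2.
Qed.

Lemma derive_ge0_of_ge_right f x d b : is_derive x 1 f d -> x < b ->
  (forall y, x < y <= b -> f x <= f y) -> 0 <= d.
Proof.
move=> fD xb fx; rewrite leNgt; apply/negP => /(decreases_right fD)[r r0 rP].
pose y := Num.min b (x + r / 2).
have xy : x < y by rewrite lt_min xb ltrDl divr_gt0.
have yr : y <= x + r / 2 by rewrite ge_min lexx orbT.
have yb : y <= b by rewrite ge_min lexx.
have : f x <= f y by apply: fx; rewrite xy.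
by rewrite leNgt rP // xy /=; lra.
Qed.

(** If the second derivative were positive, the first, zero at [s], would be
    positive just to the right, and [f] would exceed its maximum there. *)
Lemma second_derivative_at_max f df ddf a b s :
  (forall x, is_derive x 1 f (df x)) -> (forall x, is_derive x 1 df (ddf x)) ->
  a < s < b -> (forall x, a <= x <= b -> f x <= f s) -> df s = 0 /\ ddf s <= 0.
Proof.
move=> fD dfD /andP[as_ sb] fs.
have df0 : df s = 0.
  have [_ <-] := fD s; rewrite -derive1E.
  have sab : s \in `]a, b[%R by rewrite in_itv /= as_.
  have ab : a <= b by rewrite (le_trans (ltW as_)) // ltW.
  have [||_] := @derive1_at_max R f a b s ab _ sab.
  - by move=> x _; have [] := fD x.
  - move=> t; rewrite in_itv /= => /andP[t1 t2]; apply: fs; by rewrite !ltW.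
  by rewrite -derive1E.
split=> //; rewrite leNgt; apply/negP => ddfs.
have [r r0 rP] := increases_right (dfD s) ddfs.
pose y := Num.min b (s + r / 2).
have sy : s < y by rewrite lt_min sb ltrDl divr_gt0.
have yr : y <= s + r / 2 by rewrite ge_min lexx orbT.
have yb : y <= b by rewrite ge_min lexx.
have [c /andP[sc cy] E] := mean_value_open sy (fun x _ => fD x).
have : 0 < df c by rewrite -df0; apply: rP; rewrite sc /=; lra.
have : f y <= f s by apply: fs; rewrite yb andbT ltW // (lt_trans as_).
have : 0 < y - s by rewrite subr_gt0.
nra.
Qed.

(** A function that crosses the level [B] in both directions at arbitrarily
    late times has late local maxima above [B]. *)
Lemma late_maximum f df ddf (B : R) :
  (forall x, is_derive x 1 f (df x)) -> (forall x, is_derive x 1 df (ddf x)) ->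
  (forall X, exists2 x, X <= x & f x < B) ->
  (forall X, exists2 x, X <= x & B < f x) ->
  forall X, exists s, [/\ X <= s, B < f s, df s = 0 & ddf s <= 0].
Proof.
move=> fD dfD lo hi X.
have [a Xa fa] := lo X; have [c ac fc] := hi a; have [b cb fb] := lo c.
have ab : a <= b by exact: le_trans cb.
have [|s sab smax] := @EVT_max R f a b ab.
  by apply: within_continuous => x _; exact: is_derive_continuous (fD x).
have Bs : B < f s.
  by apply: lt_le_trans fc _; apply: smax; rewrite in_itv /= ac.
move: sab; rewrite in_itv /= => /andP[as_ sb].
have as' : a < s.
  by rewrite lt_neqAle as_ andbT; apply/eqP => E; move: Bs; rewrite -E; lra.
have sb' : s < b.
  by rewrite lt_neqAle sb andbT; apply/eqP => E; move: Bs; rewrite E; lra.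
have asb : a < s < b by rewrite as'.
have [|E1 E2] := second_derivative_at_max fD dfD asb.
  by move=> x xab; apply: smax; rewrite in_itv.
by exists s; split => //; exact: le_trans as_.
Qed.

(** The limit superior [M], by the two properties that characterize it. *)
Lemma upper_limit f (K k X0 : R) : (forall x, X0 <= x -> f x <= K) ->
  (forall X, exists2 x, X <= x & k <= f x) ->
  exists M, [/\ k <= M,
    forall e : R, 0 < e -> exists X, forall x, X <= x -> f x <= M + e &
    forall e : R, 0 < e -> forall X, exists2 x, X <= x & M - e < f x].
Proof.
move=> fK fk.
pose S : set R := [set B | exists X, forall x, X <= x -> f x <= B].
have Sk B : S B -> k <= B.
  by move=> [X XB]; have [x /XB fx kx] := fk X; exact: le_trans kx fx.
have Si : has_inf S by split; [exists K, X0|exists k].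
exists (inf S); split.
- by apply: lb_le_inf; [exact: Si.1|exact: Sk].
- move=> e e0; have [B [X XB] Be] := inf_adherent e0 Si.
  by exists X => x /XB fx; rewrite (le_trans fx) // ltW.
- move=> e e0 X; apply: contrapT => H.
  have : S (inf S - e).
    exists X => x Xx; rewrite leNgt; apply/negP => ?; apply: H.
    by exists x.
  move=> /(ge_inf Si.2); lra.
Qed.

Lemma no_escape_up f df (X M c : R) : (forall x, X <= x -> is_derive x 1 f (df x)) ->
  0 < c -> (forall x, X <= x -> f x <= M) ->
  (forall x, X <= x -> f X <= f x -> c < df x) -> False.
Proof.
move=> fD c0 fM H.
have fX := fM X (lexx _).
pose b := X + (M - f X + 1) / c.
have Xb : X <= b by rewrite lerDl divr_ge0 ?ltW //; lra.
have E : c * (b - X) = M - f X + 1.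
  by rewrite /b addrAC subrr add0r mulrC divfK // gt_eqF.
have : f X + c * (b - X) <= f b.
  apply: (pushed_up Xb (ltW c0)) => x /andP[Xx _]; [exact: fD|exact: H].
by have := fM b Xb; lra.
Qed.

Lemma no_escape_down f df (X M c : R) : (forall x, X <= x -> is_derive x 1 f (df x)) ->
  0 < c -> (forall x, X <= x -> M <= f x) ->
  (forall x, X <= x -> f x <= f X -> df x < - c) -> False.
Proof.
move=> fD c0 fM H.
apply: (@no_escape_up (- f) (- df) X (- M) c) => // x Xx.
- by have := fD x Xx => ?; exact: is_deriveN.
- by rewrite fctE lerN2; exact: fM.
- by rewrite !fctE lerN2 ltrNr; exact: H.
Qed.

End Extrema.

(** * Bounds for the logarithm of a profile *)

Section Profile.
Context {R : realType}.
Variables (eps tau : R).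

Definition drift (p w : R) : R := (p - eps * p ^+ 2 - 1 + expR w) / eps.

Variables (Q kap : R) (w p : R -> R).
Hypothesis eps_gt0 : 0 < eps.
Hypothesis eps_le : eps <= 1 / 4.
Hypothesis tau_ge0 : 0 <= tau.
Hypothesis tau_le : tau <= 3 / 2.
Hypothesis wD : forall x : R, is_derive x 1 w (p x).
Hypothesis p_range : forall x, - Q <= p x <= (2 * eps)^-1.

Let mu := (2 * eps)^-1.

Let p_le x : p x <= mu. Proof. by case/andP: (p_range x). Qed.
Let p_ge x : - Q <= p x. Proof. by case/andP: (p_range x). Qed.

Let mu_gt0 : 0 < mu.
Proof. by rewrite invr_gt0 mulr_gt0. Qed.

Let eps_mu : eps * mu = 1 / 2.
Proof. by rewrite /mu; field; rewrite gt_eqF. Qed.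

Let slope_excess x : 0 <= p x -> p x / 2 <= p x - eps * p x ^+ 2.
Proof.
move=> px; have epx : eps * p x <= 1 / 2.
  by rewrite -eps_mu ler_wpM2l ?(ltW eps_gt0).
have : 0 <= p x * (1 / 2 - eps * p x) by nonneg.
lra.
Qed.

Lemma drift0_ge0 (u : R) : (0 <= drift 0 u) = (0 <= u).
Proof.
rewrite /drift expr0n mulr0 pmulr_lge0 ?invr_gt0 //.
have -> : 0 - 0 - 1 + expR u = expR u - 1 by ring.
by rewrite subr_ge0 -expR0 ler_expR.
Qed.

Lemma drift0_le0 (u : R) : (drift 0 u <= 0) = (u <= 0).
Proof.
rewrite /drift expr0n mulr0 pmulr_lle0 ?invr_gt0 //.
have -> : 0 - 0 - 1 + expR u = expR u - 1 by ring.
by rewrite subr_le0 -expR0 ler_expR.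
Qed.

Lemma level_increment x y : x <= y -> - Q * (y - x) <= w y - w x <= mu * (y - x).
Proof.
move=> xy; rewrite (increment_ge xy (fun z _ => wD z)) //.
by rewrite (increment_le xy (fun z _ => wD z)).
Qed.

(** Once the level exceeds a suitable cap with nonnegative slope, the delayed
    level is at least [1], so the slope grows for ever, beyond [mu]. *)
Lemma cap_inactive :
  (forall x : R, is_derive x 1 p (rate eps kap (p x) (w (x - tau)))) ->
  mu * (3 / 2) + 1 <= kap -> (forall x, x <= 0 -> w x <= kap) ->
  forall x, w x <= kap.
Proof.
have [e0 t0 t1 m0] := And4 eps_gt0 tau_ge0 tau_le mu_gt0.
move=> pD kapE w_neg x0; rewrite leNgt; apply/negP => x0k.
have x0p : 0 <= x0.
  by rewrite leNgt; apply/negP => /ltW/w_neg; rewrite leNgt x0k.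
have [||||z [/andP[_ zx0] wz zP]] := @last_zero R (fun x => w x - kap) 0 x0.
- by move=> x _; apply: cvgB; [exact: is_derive_continuous (wD x)|exact: cvg_cst].
- exact: x0p.
- by have := w_neg 0 (lexx _); lra.
- lra.
have {}wz : w z = kap by lra.
have pz : 0 <= p z.
  by apply: (derive_ge0_of_ge_right (wD z) zx0) => y /zP; lra.
have e2 := expR_ge1Dx (1 : R).
have delayed x : z <= x -> (forall y, z <= y <= x -> 0 <= p y) ->
    1 <= expR (Num.min (w (x - tau)) kap) - 1.
  move=> zx px; have := increment_ge zx (fun z _ => wD z) px.
  have : w x - w (x - tau) <= mu * tau.
    have /andP[_] : - Q * (x - (x - tau)) <= w x - w (x - tau) <= mu * (x - (x - tau)).
      by apply: level_increment; lra.
    by have -> : x - (x - tau) = tau by ring.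
  rewrite mul0r => H1 H2.
  have : mu * tau <= mu * (3 / 2) by rewrite ler_wpM2l ?(ltW m0).
  move=> H3; have : expR 1 <= expR (Num.min (w (x - tau)) kap).
    by rewrite ler_expR le_min; apply/andP; split; nra.
  lra.
have pos x : z <= x -> 0 <= p x.
  move=> zx; apply: (@trapped R p (fun x => rate eps kap (p x) (w (x - tau))) z x) => //.
  - move=> y /andP[zy _] py pyz; rewrite /rate pyz divr_gt0 //.
    by have := delayed y zy py; rewrite expr0n mulr0; lra.
  - by rewrite zx lexx.
apply: (@no_escape_up R p (fun x => rate eps kap (p x) (w (x - tau))) z mu (1 / 2 / eps)) => //.
  by rewrite divr_gt0.
move=> x zx _; rewrite /rate ltr_pM2r ?invr_gt0 //.
have := delayed x zx (fun y zyx => pos y (andP zyx).1).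
have := slope_excess (pos x zx); have := pos x zx; lra.
Qed.

Hypothesis pD : forall x : R, is_derive x 1 p (drift (p x) (w (x - tau))).

(** While the level stays below [-1], slopes less than [1/4] would decrease out
    of the admissible range. *)
Lemma climbs_from_minus_infinity : (forall x, x <= 0 -> w x <= - 1) ->
  exists X : R, forall x, x <= X -> w x <= (x - X) / 4 - 1.
Proof.
have [e0 t0 m0] := And3 eps_gt0 tau_ge0 mu_gt0.
move=> w_neg; pose X := - (8 * eps * (`|Q| + 1 / 4)).
have X0 : X <= 0 by rewrite oppr_le0; nonneg.
have p4 x : x <= X -> 1 / 4 <= p x.
  move=> xX; rewrite leNgt; apply/negP => px.
  have x0 : x <= 0 by exact: le_trans X0.
  have c0 : 0 <= 1 / (8 * eps) by nonneg.
  have : p 0 <= p x - 1 / (8 * eps) * (0 - x).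
    apply: (pushed_down x0 c0 (fun y _ => pD y)) => y /andP[xy y0] pyx.
    have -> : - (1 / (8 * eps)) = (- (1 / 8)) / eps by field; rewrite gt_eqF.
    rewrite /drift ltr_pM2r ?invr_gt0 //.
    have : expR (w (y - tau)) <= expR (- 1) by rewrite ler_expR w_neg //; lra.
    have := @expRN1_le_half R.
    have : 0 <= eps * p y ^+ 2 by nonneg.
    lra.
  have : `|Q| + 1 / 4 <= 1 / (8 * eps) * (0 - x).
    have -> : 1 / (8 * eps) * (0 - x) = (- x) / (8 * eps).
      by field; rewrite gt_eqF.
    rewrite ler_pdivlMr ?mulr_gt0 //.
    by rewrite /X in xX; lra.
  by have := p_ge 0; have := ler_norm Q; lra.
exists X => x xX.
have := w_neg X X0.
have : 1 / 4 * (X - x) <= w X - w x.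
  by apply: (increment_ge xX (fun y _ => wD y)) => y /andP[_ yX]; exact: p4.
lra.
Qed.

(** If [w <= - a] for ever, the slope must stay above a positive constant, since
    a smaller slope would decrease below [- Q]; but then [w] is unbounded. *)
Lemma not_eventually_below (a X : R) : 0 < a -> ~ (forall x, X <= x -> w x <= - a).
Proof.
have [e0 t0] := conj eps_gt0 tau_ge0.
move=> a0 wa; pose b := 1 - expR (- a).
have b0 : 0 < b by rewrite subr_gt0 expR_lt1 oppr_lt0.
have pb x : X + tau <= x -> b / 2 <= p x.
  move=> Xx; rewrite leNgt; apply/negP => px.
  apply: (@no_escape_down R p _ x (- Q) (b / 4 / eps) (fun y _ => pD y)) => //.
    by rewrite !divr_gt0.
  move=> y xy pyx; rewrite /drift -[ltRHS]mulNr ltr_pM2r ?invr_gt0 //.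
  have : expR (w (y - tau)) <= expR (- a) by rewrite ler_expR wa //; lra.
  have : 0 <= eps * p y ^+ 2 by nonneg.
  by rewrite /b in px b0 *; lra.
apply: (@no_escape_up R w p (X + tau) (- a) (b / 4) (fun y _ => wD y)).
- by rewrite divr_gt0.
- by move=> x Xx; apply: wa; lra.
- by move=> x /pb; lra.
Qed.

Lemma not_eventually_above (a X : R) : 0 < a -> ~ (forall x, X <= x -> a <= w x).
Proof.
have [e0 e4 t0 m0] := And4 eps_gt0 eps_le tau_ge0 mu_gt0.
move=> a0 wa; pose b := Num.min 1 (expR a - 1).
have b0 : 0 < b by rewrite lt_min ltr01 subr_gt0 expR_gt1.
have b1 : b <= 1 by rewrite ge_min lexx.
have ba : b <= expR a - 1 by rewrite ge_min lexx orbT.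
have pb x : X + tau <= x -> p x <= - (b / 4).
  move=> Xx; rewrite leNgt; apply/negP => px.
  apply: (@no_escape_up R p _ x mu (b / 2 / eps) (fun y _ => pD y)) => //.
    by rewrite !divr_gt0.
  move=> y xy pyx; rewrite /drift ltr_pM2r ?invr_gt0 //.
  have : expR a <= expR (w (y - tau)) by rewrite ler_expR wa //; lra.
  have : - (b / 4) * (5 / 4) <= p y - eps * p y ^+ 2.
    have [py|py] := leP 0 (p y).
      by have := slope_excess py; lra.
    have : p y ^+ 2 <= (b / 4) ^+ 2 by nra.
    have : 0 <= p y ^+ 2 by nonneg.
    nra.
  lra.
apply: (@no_escape_down R w p (X + tau) a (b / 8) (fun y _ => wD y)).
- by rewrite divr_gt0.
- by move=> x Xx; apply: wa; lra.
- by move=> x /pb; lra.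
Qed.

(** A slope below [1 - exp M] would decrease for ever at a definite rate. *)
Lemma slope_lower_bound (M X : R) : 0 < M -> (forall x, X <= x -> w x <= M) ->
  forall x, X + tau <= x -> - (expR M - 1) <= p x.
Proof.
have [e0 t0] := conj eps_gt0 tau_ge0.
move=> M0 wM x Xx; rewrite leNgt; apply/negP => px.
pose c := (- (expR M - 1) - p x) / 2.
apply: (@no_escape_down R p _ x (- Q) (c / eps) (fun y _ => pD y)) => //.
  by rewrite divr_gt0 // /c; lra.
move=> y xy pyx; rewrite /drift -[ltRHS]mulNr ltr_pM2r ?invr_gt0 //.
have : expR (w (y - tau)) <= expR M by rewrite ler_expR wM //; lra.
have : 0 <= eps * p y ^+ 2 by nonneg.
by rewrite /c; lra.
Qed.

(** On [[0, mu]] the function [p - eps p^2] increases, so a slope above [S] would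
    grow for ever at a definite rate. *)
Lemma slope_upper_bound (m S X : R) : (forall x, X <= x -> - m <= w x) ->
  1 - expR (- m) <= S - eps * S ^+ 2 -> forall x, X + tau <= x -> p x <= S.
Proof.
have [e0 t0] := conj eps_gt0 tau_ge0.
move=> wm GS x Xx; rewrite leNgt; apply/negP => px.
have quad u v : u <= v -> v <= mu -> u - eps * u ^+ 2 <= v - eps * v ^+ 2.
  move=> uv vmu; have : 0 <= (v - u) * (eps * (mu - v) + eps * (mu - u)).
    by nonneg; lra.
  by have := eps_mu; nra.
have quad' : S - eps * S ^+ 2 < p x - eps * p x ^+ 2.
  have : 0 < (p x - S) * (eps * (mu - p x) + eps * (mu - S)).
    have := p_le x => *; rewrite mulr_gt0 ?subr_gt0 // ltr_wpDl //; first by nonneg.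
    by rewrite mulr_gt0 // subr_gt0; lra.
  by have := eps_mu; nra.
pose c := (p x - eps * p x ^+ 2 - (S - eps * S ^+ 2)) / 2.
have c0 : 0 < c by rewrite divr_gt0 // subr_gt0.
apply: (@no_escape_up R p _ x mu (c / eps) (fun y _ => pD y)) => //.
  by rewrite divr_gt0.
move=> y xy pxy; rewrite /drift ltr_pM2r ?invr_gt0 //.
have : expR (- m) <= expR (w (y - tau)) by rewrite ler_expR wm //; lra.
by have := quad _ _ pxy (p_le y); rewrite /c in c0 *; lra.
Qed.

End Profile.

(** * Differentiation rules *)

Section DerivativeRules.
Context {R : realType}.
Implicit Types (f g : R -> R) (x d e a : R).

(** The differentiation rules in the applied form [fun y => f y * g y], which
    lets derivatives of composite expressions be assembled by unification. *)
Lemma dcst a x : is_derive x 1 (fun=> a) 0.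
Proof. exact: is_derive_cst. Qed.

Lemma did x : is_derive x 1 (fun y => y) 1.
Proof. exact: is_derive_id. Qed.

Lemma dadd f g x d e : is_derive x 1 f d -> is_derive x 1 g e ->
  is_derive x 1 (fun y => f y + g y) (d + e).
Proof. by move=> ? ?; exact: is_deriveD. Qed.

Lemma dopp f x d : is_derive x 1 f d -> is_derive x 1 (fun y => - f y) (- d).
Proof. by move=> ?; exact: is_deriveN. Qed.

Lemma dmul f g x d e : is_derive x 1 f d -> is_derive x 1 g e ->
  is_derive x 1 (fun y => f y * g y) (d * g x + f x * e).
Proof.
move=> fD gD; apply: is_derive_eq (is_deriveM fD gD) _.
by rewrite /GRing.scale /= addrC mulrC.
Qed.

Lemma dexp f x d : is_derive x 1 f d ->
  is_derive x 1 (fun y => expR (f y)) (expR (f x) * d).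
Proof. by move=> fD; exact: is_derive1_comp (is_derive_expR (f x)) fD. Qed.

Lemma daffine a e x : is_derive x 1 (fun y => a + e * y) e.
Proof.
apply: is_derive_eq (dadd (dcst a x) (dmul (dcst e x) (did x))) _.
by rewrite mul0r !add0r mulr1.
Qed.

Lemma dshift f x d a : is_derive (x + a) 1 f d ->
  is_derive x 1 (fun y => f (y + a)) d.
Proof.
move=> fD; have aD : is_derive x 1 (fun y => y + a) 1.
  apply: is_derive_eq (dadd (did x) (dcst a x)) _; exact: addr0.
by have := is_derive1_comp (g := fun y => y + a) fD aD; rewrite mulr1.
Qed.

Lemma dreflect f x d a : is_derive (a - x) 1 f d ->
  is_derive x 1 (fun y => f (a - y)) (- d).
Proof.
move=> fD; have aD : is_derive x 1 (fun y => a - y) (- 1).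
  apply: is_derive_eq (dadd (dcst a x) (dopp (did x))) _; exact: add0r.
by have := is_derive1_comp (g := fun y => a - y) fD aD; rewrite mulrN1.
Qed.

(** The half line starts at [-1] rather than [0] so that the derivative at [0] is
    two-sided. *)
Lemma antiderivative f : continuous f ->
  exists F : R -> R, F 0 = 0 /\ forall x, -1 < x -> is_derive x 1 F (f x).
Proof.
move=> fc; pose F (y : R) := (\int[lebesgue_measure]_(t in `[(-1 : R), y]) f t)%R.
exists (fun y => F y - F 0); split; first by rewrite subrr.
move=> x x1.
have xu : x < x + 1 by rewrite ltrDl.
have fi : lebesgue_measure.-integrable `[(-1 : R), x + 1] (EFin \o f).
  apply: continuous_compact_integrable; first exact: segment_compact.
  exact: continuous_subspaceT.
have [dF EF] := continuous_FTC1_closed xu fi x1 (fc x).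
have FD : is_derive x 1 F (f x) by apply: DeriveDef; [exact: dF|rewrite -derive1E; exact: EF].
apply: is_derive_eq (dadd FD (dcst (- F 0) x)) _; exact: addr0.
Qed.

End DerivativeRules.

(** * Troughs and crests *)

Section TroughAndCrest.
Context {R : realType}.
Variables (eps tau Q : R) (w p : R -> R).
Hypothesis eps_gt0 : 0 < eps.
Hypothesis eps_le : eps <= 1 / 4.
Hypothesis tau_ge0 : 0 <= tau.
Hypothesis tau_le : tau <= 3 / 2.
Hypothesis wD : forall x : R, is_derive x 1 w (p x).
Hypothesis pD : forall x : R, is_derive x 1 p (drift eps (p x) (w (x - tau))).

(** At a local minimum [s] with [w s < 0] the delayed level is nonnegative, so
    [w] has a last zero [z] in [[s - tau, s]]. There [eps p - w] has derivative
    at most [exp (w (x - tau)) - 1], where [w (x - tau)] is at most [M] and, the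
    slope being at least [- E] with [E = exp M - 1], at most [E (z + tau - x)].
    The integral of [exp (min M (E u)) - 1] over [0 <= u <= 3 / 2] is the
    bound. *)
Lemma trough_bound (M X s : R) : 0 < M -> (forall x, X <= x -> w x <= M) ->
  (forall x, X <= x -> - (expR M - 1) <= p x) -> X + 2 * tau <= s ->
  p s = 0 -> 0 <= drift eps (p s) (w (s - tau)) ->
  - w s <= 3 / 2 * (expR M - 1) + 1 - M - M / (expR M - 1).
Proof.
have [e0 t0 t1] := And3 eps_gt0 tau_ge0 tau_le.
move=> M0 wM; set E := expR M - 1 => pE Xs ps0 ds.
have ME : M <= E by have := expR_ge1Dx M; rewrite /E; lra.
have E0 : 0 < E by lra.
pose u := M / E.
have uE : E * u = M by rewrite /u mulrC divfK // gt_eqF.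
have u1 : u <= 1 by rewrite ler_pdivrMr // mul1r.
have u0 : 0 < u by rewrite divr_gt0.
rewrite -/u.
have [ws|ws] := leP 0 (w s); first by nra.
have wst : 0 <= w (s - tau) by move: ds; rewrite ps0 drift0_ge0.
have [||||z [/andP[sz zs] wz zP]] := @last_zero R (fun x => - w x) (s - tau) s.
- by move=> x _; apply: cvgN; exact: is_derive_continuous (wD x).
- lra.
- lra.
- lra.
have {}wz : w z = 0 by lra.
have pz : p z <= 0.
  rewrite -oppr_ge0.
  by apply: (derive_ge0_of_ge_right (dopp (wD z)) zs) => y /zP; lra.
pose Z x := eps * p x - w x.
have ZD (x : R) : is_derive x 1 Z (- eps * p x ^+ 2 - 1 + expR (w (x - tau))).
  apply: is_derive_eq (dadd (dmul (dcst eps x) (pD x)) (dopp (wD x))) _.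
  by rewrite /drift; field; rewrite gt_eqF.
have early x : z <= x <= s -> w (x - tau) <= M /\ w (x - tau) <= E * (z + tau - x).
  move=> /andP[zx xs]; split; first by apply: wM; lra.
  have xz : x - tau <= z by lra.
  have := increment_ge xz (fun y _ => wD y) (K := - E).
  rewrite wz => K; have := K _; have {}K : - E * (z - (x - tau)) <= 0 - w (x - tau).
    by apply: K => y /andP[xy _]; apply: pE; lra.
  by lra.
have sq0 x : 0 <= eps * p x ^+ 2 by nonneg.
pose y := Num.max z (Num.min s (z + tau - u)).
have zy : z <= y by rewrite le_max lexx.
have ys : y <= s by rewrite ge_max (ltW zs) ge_min lexx.
have yz : y - z <= 3 / 2 - u.
  have : y <= Num.max z (z + tau - u) by rewrite ge_max le_max lexx le_max !ge_min lexx !orbT.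
  by case: (leP z (z + tau - u)) => ?; lra.
have part1 : Z y - Z z <= E * (y - z).
  apply: (increment_le zy (fun x _ => ZD x)) => x /andP[zx xy].
  have [xM _] : w (x - tau) <= M /\ w (x - tau) <= E * (z + tau - x).
    by apply: early; rewrite zx (le_trans xy).
  by move: xM; rewrite -ler_expR; have := sq0 x; rewrite /E; lra.
have part2 : Z s - Z y <= 1 - u.
  have [sy|{}ys] := leP s y.
    have -> : y = s by apply/eqP; rewrite eq_le ys sy.
    by rewrite subrr subr_ge0.
  have vu : z + tau - y <= u.
    have : Num.min s (z + tau - u) <= y by rewrite le_max lexx orbT.
    by rewrite ge_min leNgt ys /=; lra.
  pose psi v := expR (E * v) / E - v.
  have psiD (v : R) : is_derive v 1 psi (expR (E * v) - 1).
    apply: is_derive_eq (dadd (dmul (dexp (dmul (dcst E v) (did v))) (dcst E^-1 v)) (dopp (did v))) _.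
    by field; rewrite gt_eqF.
  have psi_incr v v' : 0 <= v -> v <= v' -> psi v <= psi v'.
    move=> v0 vv; rewrite -subr_ge0 -(mul0r (v' - v)).
    apply: (increment_ge vv (fun x _ => psiD x)) => x /andP[vx _].
    by rewrite subr_ge0 -expR0 ler_expR mulr_ge0 ?(ltW E0) // (le_trans v0).
  have -> : 1 - u = psi u - psi 0.
    have EM : expR M = E + 1 by rewrite subrK.
    by rewrite /psi uE mulr0 expR0 EM; field; rewrite gt_eqF.
  have : Z s - Z y <= - psi (z + tau - s) - - psi (z + tau - y).
    apply: (@derive_le R Z _ (fun x => - psi (z + tau - x))
      (fun x => expR (E * (z + tau - x)) - 1) y s (ltW ys) (fun x _ => ZD x)).
      move=> x _; apply: is_derive_eq (dopp (dreflect (psiD (z + tau - x)))) _.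
      exact: opprK.
    move=> x /andP[yx xs] /=.
    have [_ xE] : w (x - tau) <= M /\ w (x - tau) <= E * (z + tau - x).
      by apply: early; rewrite (le_trans zy).
    by move: xE; rewrite -ler_expR; have := sq0 x; lra.
  have := psi_incr (z + tau - y) u ltac:(lra) vu.
  have := psi_incr 0 (z + tau - s) (lexx _) ltac:(lra).
  by lra.
have : E * (y - z) <= E * (3 / 2 - u) by rewrite ler_wpM2l // ltW.
have : eps * p z <= 0 by rewrite mulr_ge0_le0 // ltW.
move: part1 part2; rewrite /Z ps0 wz mulr0 => part1 part2.
by rewrite (mulrBr E (3 / 2)) uE; lra.
Qed.

(** The delayed growth rate [1 - exp (w (x - tau))] at distance [u] before the
    time when the delayed argument would see a zero of [w] is at most
    [envelope m S u] if [w] is bounded below by [- m] and has slope at most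
    [S]. *)
Definition envelope (m S u : R) : R := 1 - expR (- Num.min m (S * u)).

Lemma continuous_envelope (m S : R) : continuous (envelope m S).
Proof.
move=> x; apply: cvgB; first exact: cvg_cst.
apply: continuous_comp; last exact: continuous_expR.
apply: cvgN; apply: continuous_min; first exact: cvg_cst.
by apply: cvgM; [exact: cvg_cst|exact: cvg_id].
Qed.

Lemma envelope_incr (m S u v : R) : 0 <= S -> u <= v ->
  envelope m S u <= envelope m S v.
Proof.
move=> S0 uv; rewrite lerD2l lerN2 ler_expR lerN2 le_min !ge_min lexx /=.
by rewrite (ler_wpM2l S0 uv) orbT.
Qed.

Lemma envelope_ge0 (m S u : R) : 0 <= m -> 0 <= S -> 0 <= u -> 0 <= envelope m S u.
Proof.
move=> m0 S0 u0; rewrite subr_ge0 -expR0 ler_expR oppr_le0 le_min m0.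
by rewrite mulr_ge0.
Qed.

Lemma envelope_le1 (m S u : R) : envelope m S u <= 1.
Proof. by rewrite gerDl oppr_le0 expR_ge0. Qed.

(** The response [l] of the linear equation [eps l' = g - k l], [l 0 = 0], to a
    continuous nondecreasing nonnegative rate [g], with its primitive [L]. *)
Lemma linear_response (k : R) (g G : R -> R) : 0 < k ->
  (forall x : R, -1 < x -> is_derive x 1 G (g x)) -> G 0 = 0 ->
  (forall x, 0 <= x -> 0 <= g x) -> (forall x y, x <= y -> g x <= g y) ->
  exists l L : R -> R,
    [/\ l 0 = 0, L 0 = 0, forall x : R, 0 <= x -> is_derive x 1 L (l x),
        forall x : R, 0 <= x -> is_derive x 1 l ((g x - k * l x) / eps)
      & [/\ forall x, 0 <= x -> 0 <= l x, forall x, 0 <= x -> k * l x <= g x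
          & forall x, 0 <= x -> eps * l x + k * L x = G x]].
Proof.
have e0 := eps_gt0.
move=> k0 GD G0 g0 gincr.
pose c := k / eps.
have ce : eps * c = k by rewrite /c mulrC divfK // gt_eqF.
have c0 : 0 < c by rewrite divr_gt0.
(* [G], hence its product with the integrating factor, is only known to be
   differentiable to the right of [-1]; it is continued by a constant. *)
pose H x := expR (c * x) * G (Num.max (- 1 / 2) x) / eps.
have Hc : continuous H.
  move=> x; apply: cvgM; last exact: cvg_cst.
  apply: cvgM.
    apply: continuous_comp; last exact: continuous_expR.
    by apply: cvgM; [exact: cvg_cst|exact: cvg_id].
  apply: continuous_comp.
    by apply: continuous_max; [exact: cvg_cst|exact: cvg_id].
  have x1 : -1 < Num.max (-1 / 2) x by rewrite lt_max; apply/orP; left; lra.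
  exact: is_derive_continuous (GD _ x1).
have [K [K0 KD]] := antiderivative Hc.
pose L x := expR (- c * x) * K x.
pose l x := (G x - k * L x) / eps.
have eD (a x : R) : is_derive x 1 (fun y => expR (a * y)) (a * expR (a * x)).
  apply: is_derive_eq (dexp (dmul (dcst a x) (did x))) _.
  by rewrite mul0r add0r mulr1 mulrC.
have LD (x : R) : 0 <= x -> is_derive x 1 L (l x).
  move=> x0; have x1 : -1 < x by lra.
  apply: is_derive_eq (dmul (eD (- c) x) (KD x x1)) _.
  rewrite /l /L /H max_r; last lra.
  have EE : expR (- c * x) * expR (c * x) = 1 by rewrite -expRD mulNr addNr expR0.
  by rewrite !mulrA EE -ce; field; rewrite gt_eqF.
have lD (x : R) : 0 <= x -> is_derive x 1 l ((g x - k * l x) / eps).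
  move=> x0; have x1 : -1 < x by lra.
  apply: is_derive_eq (dmul (dadd (GD x x1) (dopp (dmul (dcst k x) (LD x x0)))) (dcst eps^-1 x)) _.
  by ring.
have l0 : l 0 = 0 by rewrite /l /L G0 K0 !mulr0 subrr mul0r.
exists l, L; split => //; first by rewrite /L K0 mulr0.
pose m a x := expR (c * x) * (k * l x - a).
have mD (a x : R) : 0 <= x -> is_derive x 1 (m a) (c * expR (c * x) * (g x - a)).
  move=> x0.
  apply: is_derive_eq (dmul (eD c x) (dadd (dmul (dcst k x) (lD x x0)) (dcst (- a) x))) _.
  by rewrite -ce; field; rewrite gt_eqF.
have ec x : 0 < expR (c * x) by exact: expR_gt0.
split => x x0.
- have : 0 * (x - 0) <= m 0 x - m 0 0.
    apply: (increment_ge x0 (df := fun x => c * expR (c * x) * (g x - 0))).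
      by move=> y /andP[y0 _]; exact: mD.
    by move=> y /andP[y0 _]; have := g0 y y0; have := ec y => *; rewrite subr0; nonneg.
  have -> : m 0 0 = 0 by rewrite /m l0 subr0 !mulr0.
  rewrite mul0r subr0 /m subr0 => H0.
  by rewrite -(pmulr_rge0 _ k0) -(pmulr_rge0 _ (ec x)).
- have : m (g x) x - m (g x) 0 <= 0 * (x - 0).
    apply: (increment_le x0 (df := fun y => c * expR (c * y) * (g y - g x))).
      by move=> y /andP[y0 _]; exact: mD.
    move=> y /andP[y0 yx]; rewrite mulr_ge0_le0 // ?subr_le0 ?gincr //.
    by have := ec y => *; nonneg.
  rewrite /m mul0r l0 !mulr0 expR0 mul1r sub0r opprK => H0.
  have : expR (c * x) * (k * l x - g x) <= 0 by have := g0 x x0; lra.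
  by rewrite pmulr_rle0 // subr_le0.
- by rewrite /l; field; rewrite gt_eqF.
Qed.

(** At a local maximum [s] with [w s > 0] the delayed level is nonpositive, so [w]
    has a last zero [z] in [[s - tau, s]]. Let [p1] be the greatest slope on
    [[z, s]] and [k = 1 - eps p1]. Where [p >= 0] there,
    [eps p' >= k p - envelope m S u] with [u = z + tau - x], so if [p] exceeded
    the response [l u] once, [p - l] would grow and [p s = 0] would fail. Hence [p <= l], and [w s] is at most the
    integral [L] of [l] over [0 <= u <= 3 / 2]. Since [p1 <= lam] for
    [lam = l (3 / 2)], the first integral [eps l + k L = G] of the linear equation
    yields the last inequality. *)
Lemma crest_bound (m S X s Gam : R) : 0 < m -> 0 < S ->
  (forall x, X <= x -> - m <= w x) -> (forall x, X <= x -> p x <= S) ->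
  X + 2 * tau <= s -> p s = 0 -> drift eps (p s) (w (s - tau)) <= 0 -> 0 < w s ->
  (forall x, p x <= (2 * eps)^-1) ->
  (forall G : R -> R, G 0 = 0 ->
     (forall x : R, -1 < x -> is_derive x 1 G (envelope m S x)) -> G (3 / 2) <= Gam) ->
  exists L lam : R, [/\ w s <= L, L <= 3 / 2 * lam, 0 <= lam, eps * lam <= 1 / 2
    & L * (1 - eps * lam) <= Gam - eps * lam].
Proof.
have [e0 t0 t1] := And3 eps_gt0 tau_ge0 tau_le.
move=> m0 S0 wm pS Xs ps0 ds ws pmu GamP.
have S0' := ltW S0.
have wst : w (s - tau) <= 0 by move: ds; rewrite ps0 drift0_le0.
have [||||z [/andP[sz zs] wz zP]] := @last_zero R w (s - tau) s.
- by move=> x _; exact: is_derive_continuous (wD x).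
- lra.
- lra.
- lra.
have [|x1 x1zs x1P] := @EVT_max R p z s (ltW zs).
  by apply: within_continuous => x _; exact: is_derive_continuous (pD x).
move: x1zs; rewrite in_itv /= => /andP[zx1 x1s].
have {}x1P x : z <= x <= s -> p x <= p x1 by move=> xzs; apply: x1P; rewrite in_itv.
pose k := 1 - eps * p x1.
have p1 : 0 <= p x1 by rewrite -ps0; apply: x1P; rewrite (ltW zs) lexx.
have ep1 : eps * p x1 <= 1 / 2.
  have -> : 1 / 2 = eps * (2 * eps)^-1 by field; rewrite gt_eqF.
  by rewrite ler_wpM2l // ltW.
have k2 : 1 / 2 <= k by rewrite /k; lra.
have k0 : 0 < k by lra.
have [G [G0 GD]] := antiderivative (@continuous_envelope m S).
have env0 (x : R) : 0 <= x -> 0 <= envelope m S x by apply: envelope_ge0; exact: ltW.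
have [l [L [l0 L0 LD lD [l_ge0 kl lL]]]] :=
  linear_response k0 GD G0 env0 (fun x y => @envelope_incr m S x y S0').
have lincr x y : 0 <= x -> x <= y -> l x <= l y.
  move=> x0 xy; rewrite -subr_ge0 -(mul0r (y - x)).
  apply: (@increment_ge R l (fun x => (envelope m S x - k * l x) / eps) x y xy _ 0).
    by move=> v /andP[xv _]; apply: lD; exact: le_trans xv.
  move=> v /andP[xv _]; rewrite divr_ge0 ?(ltW e0) // subr_ge0 kl //.
  exact: le_trans xv.
have Lincr x y : 0 <= x -> x <= y -> L x <= L y.
  move=> x0 xy; rewrite -subr_ge0 -(mul0r (y - x)).
  apply: (increment_ge xy (df := l)) => v /andP[xv _].
    by apply: LD; exact: le_trans xv.
  by apply: l_ge0; exact: le_trans xv.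
have pl x : z <= x <= s -> p x <= l (z + tau - x).
  move=> /andP[zx xs]; rewrite leNgt; apply/negP => D0.
  pose D y := p y - l (z + tau - y).
  have DD (y : R) : x <= y <= s -> is_derive y 1 D
      (drift eps (p y) (w (y - tau)) +
       (envelope m S (z + tau - y) - k * l (z + tau - y)) / eps).
    move=> /andP[xy ys]; have u0 : 0 <= z + tau - y by lra.
    apply: is_derive_eq (dadd (pD y) (dopp (dreflect (lD _ u0)))) _.
    by rewrite opprK.
  have : D x + 0 * (s - x) <= D s.
    apply: (pushed_up xs (lexx _) DD) => y /andP[xy ys] Dxy.
    have u0 : 0 <= z + tau - y by lra.
    have l0' := l_ge0 _ u0.
    have pyl : l (z + tau - y) < p y by rewrite /D in Dxy; lra.
    have py1 : p y <= p x1 by apply: x1P; rewrite (le_trans zx).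
    have env : 1 - expR (w (y - tau)) <= envelope m S (z + tau - y).
      rewrite lerD2l lerN2 ler_expR lerNl le_min.
      apply/andP; split; first by rewrite lerNl; apply: wm; lra.
      have yz : y - tau <= z by lra.
      have : w z - w (y - tau) <= S * (z - (y - tau)).
        by apply: (increment_le yz (fun v _ => wD v)) => v /andP[yv _]; apply: pS; lra.
      by rewrite wz sub0r; have -> : z - (y - tau) = z + tau - y by ring.
    rewrite /drift -mulrDl divr_gt0 //.
    have : 0 <= p y * (eps * (p x1 - p y)) by nonneg; lra.
    have : 0 < k * (p y - l (z + tau - y)) by rewrite mulr_gt0 // subr_gt0.
    by rewrite /k; lra.
  rewrite mul0r addr0 /D ps0.
  by have := l_ge0 (z + tau - s) ltac:(lra); lra.
pose lam := l (3 / 2); exists (L (3 / 2)), lam.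
have lam0 : 0 <= lam by apply: l_ge0.
have L32 : 0 <= L (3 / 2) by rewrite -L0; apply: Lincr.
have p1lam : p x1 <= lam.
  apply: le_trans (pl x1 _) _; first by rewrite zx1.
  by apply: lincr; lra.
split => //.
- have : w s - w z <= - L (z + tau - s) - - L (z + tau - z).
    apply: (@derive_le R w p (fun x => - L (z + tau - x)) (fun x => l (z + tau - x))
      z s (ltW zs) (fun x _ => wD x)) => [x /andP[zx xs]|]; last exact: pl.
    have u0 : 0 <= z + tau - x by lra.
    by apply: is_derive_eq (dopp (dreflect (LD _ u0))) _; exact: opprK.
  have := Lincr 0 (z + tau - s) (lexx _) ltac:(lra).
  have := Lincr (z + tau - z) (3 / 2) ltac:(lra) ltac:(lra).
  by rewrite wz L0; lra.
- have := @increment_le R L l 0 (3 / 2) _ _ lam.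
  rewrite L0 !subr0 [3 / 2 * lam]mulrC; apply => //.
    by move=> x /andP[x0 _]; exact: LD.
  by move=> x /andP[x0 x32]; exact: lincr.
- have := kl (3 / 2) ltac:(lra); rewrite -/lam.
  have := envelope_le1 m S (3 / 2).
  have : 0 <= (k - 1 / 2) * lam by nonneg.
  have := ler_wpM2r lam0 eps_le.
  lra.
- have := GamP G G0 GD; rewrite -lL // -/lam.
  have : 0 <= (eps * lam - eps * p x1) * L (3 / 2).
    by rewrite mulr_ge0 // subr_ge0 ler_wpM2l // ltW.
  by rewrite /k; lra.
Qed.

End TroughAndCrest.

(** * Bounds for the exponential *)

Section Numerics.
Context {R : realType}.
Implicit Types (x n : R).

Lemma ge0_from_derivative (f df : R -> R) (x : R) : 0 <= x ->
  (forall y : R, 0 <= y <= x -> is_derive y 1 f (df y)) ->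
  (forall y : R, 0 <= y <= x -> 0 <= df y) -> 0 <= f 0 -> 0 <= f x.
Proof.
move=> x0 fD df0 f0.
by have := increment_ge x0 fD (K := 0) df0; rewrite mul0r; lra.
Qed.

Lemma dpow (k : nat) (x : R) : is_derive x 1 (fun y => y ^+ k.+1) (k.+1%:R * x ^+ k).
Proof.
elim: k => [|k IH].
  by apply: is_derive_eq (did x) _; rewrite expr0 mulr1.
have -> : (fun y : R => y ^+ k.+2) = (fun y => y * y ^+ k.+1).
  by apply/funext => y; rewrite exprS.
apply: is_derive_eq (dmul (did x) IH) _.
by rewrite -[k.+2%:R]natr1 !exprS; ring.
Qed.

(** Each Taylor bound follows from the previous one by integration from zero. *)
Lemma expRN_bounds x : 0 <= x ->
  [/\ 1 - x <= expR (- x), expR (- x) <= 1 - x + x ^+ 2 / 2,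
      1 - x + x ^+ 2 / 2 - x ^+ 3 / 6 <= expR (- x),
      expR (- x) <= 1 - x + x ^+ 2 / 2 - x ^+ 3 / 6 + x ^+ 4 / 24 &
      1 - x + x ^+ 2 / 2 - x ^+ 3 / 6 + x ^+ 4 / 24 - x ^+ 5 / 120 <= expR (- x)].
Proof.
(* Instance resolution uses this to differentiate the polynomials below. *)
have scaled (k : nat) (a y : R) : is_derive y 1 (fun z => z ^+ k.+1 / a) (k.+1%:R * y ^+ k / a).
  by apply: is_derive_eq (dmul (dpow k y) (dcst a^-1 y)) _; rewrite mulr0 addr0.
have b1 (y : R) : 0 <= y -> 0 <= expR (- y) - (1 - y).
  by move=> _; have := expR_ge1Dx (- y); lra.
have b2 (y : R) : 0 <= y -> 0 <= 1 - y + y ^+ 2 / 2 - expR (- y).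
  move=> y0; apply: (@ge0_from_derivative (fun y => 1 - y + y ^+ 2 / 2 - expR (- y)) _ y y0).
  - by move=> z /andP[z0 _]; have := b1 z z0; rewrite expr1; lra.
  - by rewrite oppr0 expR0; lra.
have b3 (y : R) : 0 <= y -> 0 <= expR (- y) - (1 - y + y ^+ 2 / 2 - y ^+ 3 / 6).
  move=> y0; apply: (@ge0_from_derivative
    (fun y => expR (- y) - (1 - y + y ^+ 2 / 2 - y ^+ 3 / 6)) _ y y0).
  - by move=> z /andP[z0 _]; have := b2 z z0; rewrite expr1; lra.
  - by rewrite oppr0 expR0; lra.
have b4 (y : R) : 0 <= y -> 0 <= 1 - y + y ^+ 2 / 2 - y ^+ 3 / 6 + y ^+ 4 / 24 - expR (- y).
  move=> y0; apply: (@ge0_from_derivative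
    (fun y => 1 - y + y ^+ 2 / 2 - y ^+ 3 / 6 + y ^+ 4 / 24 - expR (- y)) _ y y0).
  - by move=> z /andP[z0 _]; have := b3 z z0; rewrite expr1; lra.
  - by rewrite oppr0 expR0; lra.
have b5 (y : R) : 0 <= y ->
    0 <= expR (- y) - (1 - y + y ^+ 2 / 2 - y ^+ 3 / 6 + y ^+ 4 / 24 - y ^+ 5 / 120).
  move=> y0; apply: (@ge0_from_derivative
    (fun y => expR (- y) - (1 - y + y ^+ 2 / 2 - y ^+ 3 / 6 + y ^+ 4 / 24 - y ^+ 5 / 120)) _ y y0).
  - by move=> z /andP[z0 _]; have := b4 z z0; rewrite expr1; lra.
  - by rewrite oppr0 expR0; lra.
by move=> x0; split; [have := b1 x x0|have := b2 x x0|have := b3 x x0|have := b4 x x0|have := b5 x x0]; lra.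
Qed.

Lemma expR_cubic x : 0 <= x -> 1 + x + x ^+ 2 / 2 + x ^+ 3 / 6 <= expR x.
Proof.
have scaled (k : nat) (a y : R) : is_derive y 1 (fun z => z ^+ k.+1 / a) (k.+1%:R * y ^+ k / a).
  by apply: is_derive_eq (dmul (dpow k y) (dcst a^-1 y)) _; rewrite mulr0 addr0.
have b2 (y : R) : 0 <= y -> 0 <= expR y - (1 + y + y ^+ 2 / 2).
  move=> y0; apply: (@ge0_from_derivative (fun y => expR y - (1 + y + y ^+ 2 / 2)) _ y y0).
  - by move=> z _; have := expR_ge1Dx z; rewrite expr1; lra.
  - by rewrite expR0; lra.
have b3 (y : R) : 0 <= y -> 0 <= expR y - (1 + y + y ^+ 2 / 2 + y ^+ 3 / 6).
  move=> y0; apply: (@ge0_from_derivative (fun y => expR y - (1 + y + y ^+ 2 / 2 + y ^+ 3 / 6)) _ y y0).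
  - by move=> z /andP[z0 _]; have := b2 z z0; rewrite expr1; lra.
  - by rewrite expR0; lra.
by move=> /b3; lra.
Qed.

(** The exponential is at least its Pade approximant of order two. *)
Lemma expR_pade x : 0 <= x -> 12 + 6 * x + x ^+ 2 <= expR x * (12 - 6 * x + x ^+ 2).
Proof.
have pD (a b c y : R) : is_derive y 1 (fun z => a + b * z + c * z ^+ 2) (b + 2 * c * y).
  apply: is_derive_eq (dadd (daffine a b y) (dmul (dcst c y) (dpow 1 y))) _.
  by rewrite expr1; ring.
have fD (a b c a' b' c' y : R) : is_derive y 1
    (fun z => expR z * (a + b * z + c * z ^+ 2) - (a' + b' * z + c' * z ^+ 2))
    (expR y * ((a + b) + (b + 2 * c) * y + c * y ^+ 2) - (b' + 2 * c' * y)).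
  apply: is_derive_eq (dadd (dmul (is_derive_expR y) (pD a b c y)) (dopp (pD a' b' c' y))) _.
  by ring.
have b1 (y : R) : 0 <= y -> 0 <= expR y * (2 + (-2) * y + 1 * y ^+ 2) - (2 + 0 * y + 0 * y ^+ 2).
  move=> y0; apply: (@ge0_from_derivative
    (fun z => expR z * (2 + (-2) * z + 1 * z ^+ 2) - (2 + 0 * z + 0 * z ^+ 2)) _ y y0).
  - move=> z _; have : 0 <= expR z * z ^+ 2 by nonneg.
    by lra.
  - by rewrite expR0; lra.
have b2 (y : R) : 0 <= y -> 0 <= expR y * (6 + (-4) * y + 1 * y ^+ 2) - (6 + 2 * y + 0 * y ^+ 2).
  move=> y0; apply: (@ge0_from_derivative
    (fun z => expR z * (6 + (-4) * z + 1 * z ^+ 2) - (6 + 2 * z + 0 * z ^+ 2)) _ y y0).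
  - by move=> z /andP[/b1 + _]; lra.
  - by rewrite expR0; lra.
have b3 (y : R) : 0 <= y -> 0 <= expR y * (12 + (-6) * y + 1 * y ^+ 2) - (12 + 6 * y + 1 * y ^+ 2).
  move=> y0; apply: (@ge0_from_derivative
    (fun z => expR z * (12 + (-6) * z + 1 * z ^+ 2) - (12 + 6 * z + 1 * z ^+ 2)) _ y y0).
  - by move=> z /andP[/b2 + _]; lra.
  - by rewrite expR0; lra.
by move=> /b3; lra.
Qed.

Lemma ratio_expRN_le x : 0 < x -> x <= (1 - expR (- x)) * (1 + x / 2 + x ^+ 2 / 12).
Proof.
move=> x0; have := expR_pade (ltW x0); have e0 := expR_gt0 (- x).
have E : expR (- x) * expR x = 1 by rewrite mulrC expRxMexpNx_1.
move=> /(ler_wpM2l (ltW e0)); rewrite mulrA E mul1r; lra.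
Qed.

(** The next three inequalities between polynomials arise in the sharp crest
    estimate. The last two are proved by expansion in the Bernstein basis
    [n ^+ i * (1 - n) ^+ j], in which all coefficients are positive. *)
Lemma crest_poly_inertialess x : 0 < x <= 2 ->
  -7/36 + 5/48 * x - 7/240 * x ^+ 2 + x ^+ 3 / 120 <= 0.
Proof. by move=> /andP[x0 x2]; nra. Qed.

Lemma crest_poly_critical n B : 0 <= n <= 1 -> B = 1 - n / 2 + n ^+ 2 / 6 - n ^+ 3 / 30 ->
  (B * (7/2 + n - 3 / 2 * (n * B)) - 3/2 + n/12) * (3 + 4 * n) ^+ 2 <= 21 + 22 * n.
Proof.
case/andP=> n0 n1 BE.
have term (c : R) i j : 0 <= c -> 0 <= c * n ^+ i * (1 - n) ^+ j.
  by move=> c0; rewrite !mulr_ge0 ?exprn_ge0 ?subr_ge0.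
have E : 21 + 22 * n - (B * (7/2 + n - 3/2 * (n * B)) - 3/2 + n/12) * (3 + 4 * n) ^+ 2 =
     3 * n ^+ 0 * (1 - n) ^+ 9 +
     41 / 2 * n ^+ 1 * (1 - n) ^+ 8 +
     247 / 4 * n ^+ 2 * (1 - n) ^+ 7 +
     13721 / 120 * n ^+ 3 * (1 - n) ^+ 6 +
     1811 / 12 * n ^+ 4 * (1 - n) ^+ 5 +
     2252 / 15 * n ^+ 5 * (1 - n) ^+ 4 +
     1649 / 15 * n ^+ 6 * (1 - n) ^+ 3 +
     8231 / 150 * n ^+ 7 * (1 - n) ^+ 2 +
     1647 / 100 * n ^+ 8 * (1 - n) ^+ 1 +
     1349 / 600 * n ^+ 9 * (1 - n) ^+ 0.
  by rewrite BE; field.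
rewrite -subr_ge0 E; clear - term.
do 9 (apply: addr_ge0; last by apply: term; lra).
by apply: term; lra.
Qed.

Lemma crest_poly_growth n : 0 <= n <= 1 ->
  (1 - n + n ^+ 2 / 2 - n ^+ 3 / 6 + n ^+ 4 / 24) ^+ 2 * (3 + 4 * n) <= 3 - 2 * n.
Proof.
move=> /andP[n0 n1].
have term (c : R) i j : 0 <= c -> 0 <= c * n ^+ i * (1 - n) ^+ j.
  by move=> c0; rewrite !mulr_ge0 ?exprn_ge0 ?subr_ge0.
have E : 3 - 2 * n -
      (1 - n + n ^+ 2 / 2 - n ^+ 3 / 6 + n ^+ 4 / 24) ^+ 2 * (3 + 4 * n) =
     2 * n ^+ 2 * (1 - n) ^+ 7 +
     10 * n ^+ 3 * (1 - n) ^+ 6 +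
     64 / 3 * n ^+ 4 * (1 - n) ^+ 5 +
     99 / 4 * n ^+ 5 * (1 - n) ^+ 4 +
     395 / 24 * n ^+ 6 * (1 - n) ^+ 3 +
     215 / 36 * n ^+ 7 * (1 - n) ^+ 2 +
     61 / 64 * n ^+ 8 * (1 - n) ^+ 1 +
     1 / 64 * n ^+ 9 * (1 - n) ^+ 0.
  by field.
rewrite -subr_ge0 E; clear - term.
do 7 (apply: addr_ge0; last by apply: term; lra).
by apply: term; lra.
Qed.

End Numerics.

(** * The trough map and elementary crest estimates *)

Section WrightMaps.
Context {R : realType}.
Implicit Types (eps tau m M S A : R).

Lemma expRN3 : expR (- 3) <= 1 / 13 :> R.
Proof.
have := @expR_cubic R 3 ltac:(lra); rewrite expRN => e3.
rewrite -[1/13]invf_div divr1 lef_pV2 ?posrE ?expR_gt0 //; lra.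
Qed.

Lemma expRN94 : expR (- (9 / 4)) <= 1 / 7 :> R.
Proof.
have := @expR_cubic R (9 / 4) ltac:(lra); rewrite expRN => e3.
rewrite -[1/7]invf_div divr1 lef_pV2 ?posrE ?expR_gt0 //; lra.
Qed.

Lemma expRN27 : 1 / 16 <= expR (- (27 / 10)) :> R.
Proof.
have [_ _ _ _ e5] := @expRN_bounds R (27 / 20) ltac:(lra).
have -> : - (27 / 10) = - (27 / 20) + - (27 / 20) :> R by field.
rewrite expRD; have e4 : 1 / 4 <= expR (- (27 / 20)) :> R by lra.
have := ler_pM (ltac:(lra) : 0 <= 1 / 4 :> R) (ltac:(lra) : 0 <= 1 / 4 :> R) e4 e4.
lra.
Qed.

(** A polynomial majorant of the bound for troughs. *)
Definition trough_map M := M + 2 / 3 * M ^+ 2 + M ^+ 3 / 3 + 3 / 16 * M ^+ 4.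

Lemma trough_map_incr M N : 0 <= M -> M <= N -> trough_map M <= trough_map N.
Proof.
move=> M0 MN; have N0 : 0 <= N by exact: le_trans MN.
have h k : M ^+ k <= N ^+ k by apply: lerXn2r; rewrite ?nnegrE.
have := h 2%N; have := h 3%N; have := h 4%N; rewrite /trough_map; lra.
Qed.

Lemma expR_quartic M : 0 <= M <= 11 / 10 ->
  expR M <= 1 + M + M ^+ 2 / 2 + M ^+ 3 / 6 + M ^+ 4 / 8.
Proof.
move=> /andP[M0 M1]; have [_ _ _ _ e5] := expRN_bounds M0.
have E : expR M * expR (- M) = 1 by rewrite expRxMexpNx_1.
have e0 := expR_gt0 M.
rewrite -[leLHS]mulr1 -(ler_pM2r (expR_gt0 (- M))) mulrAC E mul1r.
set q := _ - _ in e5; set pol := _ + M ^+ 4 / 8.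
have pol0 : 0 <= pol by rewrite /pol; nonneg.
apply: le_trans (ler_wpM2l pol0 e5).
suff : 0 <= pol * q - 1 by lra.
have -> : pol * q - 1 = M ^+ 4 *
    (1 / 12 - 11 / 120 * M + 17 / 360 * M ^+ 2 - 13 / 720 * M ^+ 3 +
     M ^+ 4 * (11 / 2880 - M / 960)) by rewrite /pol /q; field.
have M4 : 0 <= M ^+ 4 by rewrite exprn_ge0.
apply: (mulr_ge0 M4); apply: addr_ge0; last by apply: (mulr_ge0 M4); lra.
by clear -M0 M1; nra.
Qed.

(** Both sides have the same Taylor coefficients up to order two; the higher
    coefficients of [trough_map] leave room for the remainder. *)
Lemma trough_map_ge M : 0 < M <= 11 / 10 ->
  3 / 2 * (expR M - 1) + 1 - M - M / (expR M - 1) <= trough_map M.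
Proof.
move=> /andP[M0 M1]; have e4 := @expR_quartic M ltac:(lra).
have E0 : 0 < expR M - 1 by rewrite subr_gt0 expR_gt1.
have : 1 - M / 2 + M ^+ 2 / 12 - M ^+ 3 / 12 <= M / (expR M - 1).
  rewrite ler_pdivlMr //.
  set s := 1 - _ + _ - _.
  have s0 : 0 <= s by rewrite /s; nra.
  have := ler_wpM2l s0 e4; rewrite mulrBr.
  suff : s * (M + M ^+ 2 / 2 + M ^+ 3 / 6 + M ^+ 4 / 8) <= M by lra.
  have -> : s * (M + M ^+ 2 / 2 + M ^+ 3 / 6 + M ^+ 4 / 8) =
    M - M ^+ 5 * (13 / 144 + M / 288 + M ^+ 2 / 96) by rewrite /s; field.
  have M5 : 0 <= M ^+ 5 by rewrite exprn_ge0 ?ltW.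
  have M2 : 0 <= M ^+ 2 by rewrite exprn_ge0 ?ltW.
  by rewrite gerBl; apply: (mulr_ge0 M5); lra.
rewrite /trough_map; lra.
Qed.

Lemma trough_map_lipschitz M d : 0 <= M -> 0 <= d -> M + d <= 1 ->
  trough_map (M + d) <= trough_map M + 10 * d.
Proof.
move=> M0 d0 Md; have [M1 d1] : M <= 1 /\ d <= 1 by lra.
have pow i j : M ^+ i * d ^+ j <= 1.
  by rewrite -[leRHS]mulr1 ler_pM ?exprn_ge0 ?exprn_ile1.
have -> : trough_map (M + d) = trough_map M + d *
  (1 + 4 / 3 * M + 2 / 3 * d + M ^+ 2 + M * d + d ^+ 2 / 3 +
   3 / 4 * M ^+ 3 + 9 / 8 * (M ^+ 2 * d ^+ 1) + 3 / 4 * (M ^+ 1 * d ^+ 2) + 3 / 16 * d ^+ 3).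
  by rewrite /trough_map; field.
rewrite lerD2l mulrC ler_wpM2r //.
have := pow 2%N 0%N; have := pow 1%N 1%N; have := pow 0%N 2%N; have := pow 3%N 0%N.
have := pow 2%N 1%N; have := pow 1%N 2%N; have := pow 0%N 3%N.
rewrite !expr0 !mul1r !mulr1 !expr1; lra.
Qed.

(** [m <= trough_map M] and [M <= 3 m / (3 + 2 m)] are incompatible for
    positive [M]: the former gives [1 / m > 1 / M - 2 / 3], the latter
    [1 / M >= 1 / m + 2 / 3]. *)
Lemma no_two_cycle m M : 0 <= m -> 0 <= M <= 1 -> m <= trough_map M ->
  M * (3 + 2 * m) <= 3 * m -> M = 0.
Proof.
move=> m0 /andP[M0 M1] mM Mm; apply/eqP; rewrite eq_le M0 andbT leNgt; apply/negP => Mp.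
have d0 : 0 <= 3 - 2 * M by lra.
have := ler_wpM2r d0 mM.
suff : trough_map M * (3 - 2 * M) < 3 * M by lra.
rewrite -subr_gt0.
have -> : 3 * M - trough_map M * (3 - 2 * M) =
  M ^+ 3 * (1 / 3 + 5 / 48 * M + 3 / 8 * M ^+ 2) by rewrite /trough_map; field.
have : 0 < M ^+ 3 by rewrite exprn_gt0.
have : 0 <= M ^+ 2 by nonneg.
nra.
Qed.

(** The bound [(Gam - eps lam) / (1 - eps lam)] for [L] is monotone in [lam]. If
    [Gam >= 1] it increases, and [eps lam] is at most [1 / 2]; if [Gam <= 1] it
    decreases, and [lam] is at least [2 / 3 * L]. *)
Lemma crest_algebra (eps A L lam Gam : R) : A <= L -> L <= 3 / 2 * lam ->
  0 <= lam -> eps * lam <= 1 / 2 -> L * (1 - eps * lam) <= Gam - eps * lam ->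
  0 < eps -> eps <= 1 / 4 -> 0 <= A ->
  (1 <= Gam -> A <= 2 * Gam - 1) /\
  (Gam <= 1 -> A <= 1 /\ A + 2 / 3 * eps * (A * (1 - A)) <= Gam).
Proof.
move=> AL Llam lam0 el LG e0 e4 A0.
have el0 : 0 <= eps * lam by nonneg.
split=> [G1|G1].
  suff : L <= 2 * Gam - 1 by lra.
  rewrite leNgt; apply/negP => L2.
  have : 0 < (L - (2 * Gam - 1)) * (1 - eps * lam) by rewrite mulr_gt0 //; lra.
  have : 0 <= (Gam - 1) * (1 / 2 - eps * lam) by nonneg.
  lra.
have L1 : L <= 1.
  rewrite leNgt; apply/negP => L2.
  have : 0 < (L - 1) * (1 - eps * lam) by rewrite mulr_gt0 //; lra.
  lra.
have A1 : A <= 1 by lra.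
split => //.
have : eps * (2 / 3 * L) * (1 - L) <= eps * lam * (1 - L).
  by rewrite ler_wpM2r ?subr_ge0 // ler_wpM2l ?(ltW e0) //; lra.
have : 0 <= (L - A) * (1 + 2 / 3 * eps * (1 - L - A)).
  rewrite mulr_ge0 ?subr_ge0 //.
  have : 0 <= eps * (2 - L - A) by rewrite mulr_ge0 ?(ltW e0) //; lra.
  lra.
lra.
Qed.

Section EnvelopeIntegral.
Variables (m S : R) (G : R -> R).
Hypothesis S_gt0 : 0 < S.
Hypothesis G0 : G 0 = 0.
Hypothesis GD : forall x : R, -1 < x -> is_derive x 1 G (envelope m S x).

Let GD0 (a b : R) : 0 <= a -> forall x : R, a <= x <= b -> is_derive x 1 G (envelope m S x).
Proof. by move=> a0 x /andP[ax _]; apply: GD; lra. Qed.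

(** The bound that ignores the plateau of the envelope. *)
Lemma envelope_integral_ramp u : 0 <= u -> G u <= u - (1 - expR (- (S * u))) / S.
Proof.
have S0 := S_gt0; move=> u0.
have : G u - G 0 <= (fun x => x + expR (- (S * x)) / S) u - (fun x => x + expR (- (S * x)) / S) 0.
  apply: (@derive_le R G _ (fun x => x + expR (- (S * x)) / S)
    (fun x => 1 - expR (- (S * x))) 0 u u0 (GD0 (lexx 0))) => x _.
    apply: is_derive_eq (dadd (did x) (dmul (dexp (dopp (dmul (dcst S x) (did x)))) (dcst S^-1 x))) _.
    by field; rewrite gt_eqF.
  by rewrite lerD2l lerN2 ler_expR lerN2 ge_min lexx orbT.
rewrite G0 subr0 mulr0 oppr0 expR0 add0r => /le_trans; apply.
by rewrite mulrBl opprB; lra.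
Qed.

Lemma envelope_integral : 0 < m -> m <= 3 / 2 * S ->
  G (3 / 2) <= 3 / 2 * (1 - expR (- m)) - (1 - expR (- m) - m * expR (- m)) / S.
Proof.
have S0 := S_gt0; move=> m0 mS.
pose u := m / S.
have u0 : 0 <= u by rewrite divr_ge0 // ltW.
have u32 : u <= 3 / 2 by rewrite ler_pdivrMr.
have Su : S * u = m by rewrite /u mulrC divfK // gt_eqF.
have := envelope_integral_ramp u0; rewrite Su.
have : G (3 / 2) - G u <= (1 - expR (- m)) * (3 / 2 - u).
  apply: (increment_le u32 (GD0 u0)) => x _.
  by rewrite lerD2l lerN2 ler_expR lerN2 ge_min lexx.
have -> : 3 / 2 * (1 - expR (- m)) - (1 - expR (- m) - m * expR (- m)) / S =
  (1 - expR (- m)) * (3 / 2 - u) + (u - (1 - expR (- m)) / S).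
  by rewrite /u; field; rewrite gt_eqF.
lra.
Qed.

End EnvelopeIntegral.

End WrightMaps.

(** * The sharp crest estimate *)

Section SharpEnvelope.
Context {R : realType}.

(** The map such that [1 / crest_map m = 1 / m + 2 / 3]. *)
Definition crest_map (m : R) := 3 * m / (3 + 2 * m).

(** With [P] replaced by its upper bound, the inequality becomes affine in [eps],
    so it suffices to check it for [eps = 0] ([T0]) and [eps = 1 / 4] ([T1]). *)
Lemma sharp_envelope (eps m P : R) : 0 < eps -> eps <= 1 / 4 -> 0 < m -> m <= 2 ->
  P - eps * P ^+ 2 = 1 - expR (- m) -> 0 < P -> P <= 2 * (1 - expR (- (m / 2))) ->
  3 / 2 * (1 - expR (- m)) - (1 - expR (- m) - m * expR (- m)) / P <=
  crest_map m + 2 / 3 * eps * (crest_map m * (1 - crest_map m)).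
Proof.
move=> e0 e4 m0 m2 PE P0 Pb.
pose n := m / 2; have mE : m = 2 * n by rewrite /n; field.
have n0 : 0 < n by lra.
have n1 : n <= 1 by lra.
pose b := 1 - expR (- n).
have b0 : 0 < b by rewrite subr_gt0 expR_lt1 oppr_lt0.
have b1 : b <= 1 by rewrite gerBl expR_ge0.
pose G := 1 - expR (- m).
have G0 : 0 < G by rewrite subr_gt0 expR_lt1 oppr_lt0.
have emE : expR (- m) = 1 - G by rewrite /G; ring.
have GE : G = b * (2 - b).
  have -> : b * (2 - b) = 1 - (1 - b) * (1 - b) by ring.
  by rewrite /b !subKr -expRD /G mE; congr (1 - expR _); ring.
pose y := m / G.
pose A0 := 3 / 2 * G - 1 - m + y.
pose W := crest_map m.
have -> : 3 / 2 * (1 - expR (- m)) - (1 - expR (- m) - m * expR (- m)) / P =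
    A0 + eps * P * (1 + m - y).
  have -> : (1 - expR (- m) - m * expR (- m)) / P = (G - m * (1 - G)) * (1 - eps * P) / G.
    have EP : P * (1 - eps * P) = G by rewrite /G -PE; ring.
    have -> : P^-1 = (1 - eps * P) / G.
      apply: (mulfI (lt0r_neq0 P0)).
      by rewrite mulrA EP !mulfV ?gt_eqF.
    by rewrite -/G emE mulrA.
  by rewrite /A0 /y -/G; field; rewrite gt_eqF.
have yY : y <= 1 + m / 2 + m ^+ 2 / 12.
  by rewrite /y ler_pdivrMr // mulrC; exact: ratio_expRN_le.
have my : 0 <= 1 + m - y.
  have : 0 <= m * (6 - m) by apply: mulr_ge0; lra.
  lra.
have T0 : A0 <= W.
  rewrite /W /crest_map ler_pdivlMr; last lra.
  have [_ _ _ _ G5] := expRN_bounds (ltW m0).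
  have {G5} A5 : A0 <= m - 2 / 3 * m ^+ 2 + m ^+ 3 / 4 - m ^+ 4 / 16 + m ^+ 5 / 80.
    by rewrite /A0 /G; lra.
  apply: le_trans (ler_wpM2r _ A5) _; first lra.
  rewrite -subr_ge0.
  have -> : 3 * m - (m - 2 / 3 * m ^+ 2 + m ^+ 3 / 4 - m ^+ 4 / 16 + m ^+ 5 / 80) *
      (3 + 2 * m) =
    m ^+ 3 * (3 * - (-7/36 + 5/48 * m - 7/240 * m ^+ 2 + m ^+ 3 / 120)) by field.
  have m3 : 0 <= m ^+ 3 by rewrite exprn_ge0 ?ltW.
  by apply: (mulr_ge0 m3); have := @crest_poly_inertialess R m ltac:(lra); lra.
have T1 : A0 + b / 2 * (1 + m - y) <= W + W * (1 - W) / 6.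
  have nb : n / b <= 1 + n / 2 + n ^+ 2 / 12.
    by rewrite ler_pdivrMr // mulrC; exact: ratio_expRN_le.
  have -> : A0 + b / 2 * (1 + m - y) = b * (7 / 2 + n - 3 / 2 * b) - 1 - 2 * n + n / b.
    rewrite /A0 /y GE mE; field.
    by rewrite gt_eqF //= subr_eq0 gt_eqF //; lra.
  have -> : W + W * (1 - W) / 6 = n * ((21 + 22 * n) / (3 + 4 * n) ^+ 2).
    by rewrite /W /crest_map mE; field; rewrite gt_eqF //; lra.
  pose B := 1 - n / 2 + n ^+ 2 / 6 - n ^+ 3 / 30.
  have bB : b <= n * B.
    have [_ _ _ _ b5] := expRN_bounds (ltW n0).
    have : 0 <= n ^+ 4 * (1 - n) by rewrite mulr_ge0 ?exprn_ge0 ?subr_ge0 // ltW.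
    by rewrite /b /B; lra.
  have B1 : B <= 1.
    have : 0 <= n * (1 - n / 3) by rewrite mulr_ge0 ?(ltW n0) //; lra.
    have : 0 <= n ^+ 3 by rewrite exprn_ge0 ?ltW.
    by rewrite /B; lra.
  have nB1 : n * B <= 1 by have := ler_wpM2l (ltW n0) B1; lra.
  have incr : 0 <= (n * B - b) * (7 / 2 + n - 3 / 2 * (n * B + b)).
    by apply: mulr_ge0; [rewrite subr_ge0|lra].
  have c0 : 0 < (3 + 4 * n) ^+ 2 by rewrite exprn_gt0 //; lra.
  have p2 := @crest_poly_critical R n B ltac:(lra) erefl.
  have {}p2 : B * (7 / 2 + n - 3 / 2 * (n * B)) - 3 / 2 + n / 12 <=
      (21 + 22 * n) / (3 + 4 * n) ^+ 2 by rewrite ler_pdivlMr.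
  have := ler_wpM2l (ltW n0) p2; lra.
have Pb' : eps * P * (1 + m - y) <= eps * (2 * b) * (1 + m - y).
  by rewrite ler_wpM2r // ler_wpM2l // ltW.
have := ler_wpM2l (ltac:(lra) : 0 <= 1 - 4 * eps) T0.
have := ler_wpM2l (ltac:(lra) : 0 <= 4 * eps) T1.
rewrite -/W; lra.
Qed.

(** The largest slope that can persist under the growth bound [1 - exp (- m)]. *)
Lemma slope_root (eps m : R) : 0 < eps -> eps <= 1 / 4 -> 0 < m ->
  exists P : R, [/\ 0 < P, P - eps * P ^+ 2 = 1 - expR (- m) &
    P <= 2 * (1 - expR (- (m / 2)))].
Proof.
move=> e0 e4 m0; pose G := 1 - expR (- m).
have G0 : 0 < G by rewrite subr_gt0 expR_lt1 oppr_lt0.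
have G1 : G <= 1 by rewrite gerBl expR_ge0.
pose b := 1 - expR (- (m / 2)).
have b0 : 0 < b by rewrite subr_gt0 expR_lt1 oppr_lt0 divr_gt0.
have b1 : b <= 1 by rewrite gerBl expR_ge0.
have GE : G = b * (2 - b).
  have -> : b * (2 - b) = 1 - (1 - b) * (1 - b) by ring.
  by rewrite /b !subKr -expRD /G; congr (1 - expR _); field.
pose f (x : R) := x - eps * x ^+ 2.
have fc : continuous f.
  move=> x; apply: cvgB; first exact: cvg_id.
  by apply: cvgM; [exact: cvg_cst|apply: cvgM; exact: cvg_id].
have f0 : f 0 = 0 by rewrite /f expr0n mulr0 subrr.
have fb : G <= f (2 * b).
  have : 0 <= (1 / 4 - eps) * (4 * b ^+ 2) by apply: mulr_ge0; nonneg.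
  by rewrite /f GE; lra.
have b2 : 0 <= 2 * b by lra.
have [||P] := @IVT R f 0 (2 * b) G b2.
- exact: continuous_subspaceT.
- by rewrite f0 ge_min (ltW G0) le_max fb orbT.
rewrite in_itv /= => /andP[P0 Pb] fP.
exists P; split => //; rewrite lt_neqAle P0 andbT.
by apply/eqP => PE; move: fP G0; rewrite -PE f0 => <-; rewrite ltxx.
Qed.

Lemma crest_map_le_growth (m : R) : 0 <= m <= 2 -> crest_map m <= 1 - expR (- m).
Proof.
move=> /andP[m0 m2]; rewrite /crest_map ler_pdivrMr; last lra.
pose n := m / 2; have mE : m = 2 * n by rewrite /n; field.
have n0 : 0 <= n by lra.
have [_ _ _ q _] := expRN_bounds n0.
have -> : - m = - n + - n by lra.
rewrite expRD.
have q2 : expR (- n) * expR (- n) <=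
    (1 - n + n ^+ 2 / 2 - n ^+ 3 / 6 + n ^+ 4 / 24) ^+ 2.
  by rewrite expr2 ler_pM ?expR_ge0.
have := @crest_poly_growth R n ltac:(lra).
have := ler_wpM2r (ltac:(lra) : 0 <= 3 + 4 * n) q2.
rewrite mE; lra.
Qed.

Lemma crest_map_bounds (m : R) : 0 < m <= 2 -> 0 < crest_map m <= 1.
Proof.
move=> /andP[m0 m2]; rewrite /crest_map divr_gt0 /=; [|lra|lra].
by rewrite ler_pdivrMr; lra.
Qed.

Lemma flat_envelope (m : R) : 0 < m <= 2 ->
  3 / 2 * (1 - expR (- m)) - (1 - expR (- m) - m * expR (- m)) / (2 / 3 * m) <=
  crest_map m.
Proof.
move=> /andP[m0 m2]; have := @crest_map_le_growth m ltac:(lra).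
set g := 1 - expR (- m) => cg.
have -> : expR (- m) = 1 - g by rewrite subKr.
have -> : 3 / 2 * g - (g - m * (1 - g)) / (2 / 3 * m) = 3 / 2 * (1 - g / m).
  by field; rewrite gt_eqF.
have : crest_map m / m <= g / m by rewrite ler_pM2r ?invr_gt0.
have -> : crest_map m / m = 3 / (3 + 2 * m).
  by rewrite /crest_map; field; rewrite !gt_eqF //; lra.
have -> : crest_map m = 3 / 2 * (1 - 3 / (3 + 2 * m)).
  by rewrite /crest_map; field; rewrite gt_eqF //; lra.
lra.
Qed.

(** The slope [P] given by [slope_root] may be too flat for the envelope to
    reach its plateau within the delay; [2 / 3 * m] is the least slope for which
    it does. *)
Lemma envelope_slope (eps m : R) : 0 < eps -> eps <= 1 / 4 -> 0 < m <= 2 ->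
  exists S : R, [/\ 0 < S, 1 - expR (- m) <= S - eps * S ^+ 2, m <= 3 / 2 * S &
    3 / 2 * (1 - expR (- m)) - (1 - expR (- m) - m * expR (- m)) / S <=
    crest_map m + 2 / 3 * eps * (crest_map m * (1 - crest_map m))].
Proof.
move=> e0 e4 m02; have /andP[m0 m2] := m02.
have /andP[c0 c1] := crest_map_bounds m02.
have [P [P0 PE P2]] := slope_root e0 e4 m0.
have [Pm|mP] := leP P (2 / 3 * m); last first.
  by exists P; split; [|rewrite PE|lra|exact: sharp_envelope].
exists (2 / 3 * m); split; [by rewrite mulr_gt0| |lra|].
  rewrite -PE -subr_ge0.
  have -> : 2 / 3 * m - eps * (2 / 3 * m) ^+ 2 - (P - eps * P ^+ 2) =
    (2 / 3 * m - P) * (1 - eps * (2 / 3 * m + P)) by ring.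
  apply: mulr_ge0; first by rewrite subr_ge0.
  have : eps * (2 / 3 * m + P) <= 1 / 4 * (8 / 3) by apply: ler_pM; lra.
  lra.
have := flat_envelope m02.
have : 0 <= eps * (crest_map m * (1 - crest_map m)) by nonneg.
lra.
Qed.

(** The function [a + 2 / 3 * eps * (a * (1 - a))] increases on [[0, 1]]. *)
Lemma le_crest_map (eps m a : R) : 0 < eps -> eps <= 1 / 4 -> 0 < m <= 2 -> 0 < a ->
  (crest_map m + 2 / 3 * eps * (crest_map m * (1 - crest_map m)) <= 1 ->
   a <= 1 /\ a + 2 / 3 * eps * (a * (1 - a)) <=
     crest_map m + 2 / 3 * eps * (crest_map m * (1 - crest_map m))) ->
  a <= crest_map m.
Proof.
move=> e0 e4 m02 a0; have /andP[c0 c1] := crest_map_bounds m02.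
set c := crest_map m in c0 c1 *.
have ec : eps * c <= 1 / 4 * 1 by apply: ler_pM; lra.
have : 0 <= (1 - c) * (1 - 2 / 3 * (eps * c)) by apply: mulr_ge0; lra.
move=> G1 /(_ ltac:(lra))[a1 aG].
rewrite leNgt; apply/negP => ca.
have e2 : 0 <= eps * (2 - a - c) by apply: mulr_ge0; lra.
have : 0 < (a - c) * (1 + 2 / 3 * eps * (1 - a - c)) by apply: mulr_gt0; lra.
lra.
Qed.

Lemma limits_vanish (M m : R) : 0 <= M <= 93 / 100 -> 0 <= m <= 399 / 200 ->
  (forall d, 0 < d -> M + d <= 11 / 10 -> m <= trough_map (M + d)) ->
  (forall d, 0 < d -> m + d <= 2 -> M <= crest_map (m + d)) -> M = 0 /\ m = 0.
Proof.
move=> /andP[M0 M1] /andP[m0 m2] trough crest.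
have mM : m <= trough_map M.
  apply/ler_addgt0Pr => e e0.
  pose d := Num.min (e / 10) (1 / 100).
  have [d1 d2] : d <= e / 10 /\ d <= 1 / 100 by rewrite !ge_min !lexx orbT.
  have d0 : 0 < d by rewrite lt_min; lra.
  have := trough d d0 ltac:(lra).
  have := @trough_map_lipschitz R M d M0 ltac:(lra) ltac:(lra).
  lra.
suff ME : M = 0.
  by split => //; apply/eqP; rewrite eq_le m0 andbT; move: mM; rewrite ME /trough_map; lra.
apply: (no_two_cycle m0 _ mM); first lra.
apply/ler_addgt0Pr => e e0.
pose d := Num.min (e / 3) (1 / 200).
have [d1 d2] : d <= e / 3 /\ d <= 1 / 200 by rewrite !ge_min !lexx orbT.
have d0 : 0 < d by rewrite lt_min; lra.
have := crest d d0 ltac:(lra); rewrite /crest_map ler_pdivlMr; last lra.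
have : 0 <= M * d by rewrite mulr_ge0 // ltW.
lra.
Qed.

End SharpEnvelope.

(** * Convergence to the positive equilibrium *)

Section Convergence.
Context {R : realType}.
Variables (eps tau Q kap : R) (w p : R -> R).
Hypothesis eps_gt0 : 0 < eps.
Hypothesis eps_le : eps <= 1 / 4.
Hypothesis tau_ge0 : 0 <= tau.
Hypothesis tau_le : tau <= 3 / 2.
Hypothesis wD : forall x : R, is_derive x 1 w (p x).
Hypothesis pD : forall x : R, is_derive x 1 p (drift eps (p x) (w (x - tau))).
Hypothesis p_range : forall x, - Q <= p x <= (2 * eps)^-1.
Hypothesis w_le : forall x, w x <= kap.

Lemma frequently_below (a X : R) : 0 < a -> exists2 x, X <= x & w x < a.
Proof.
move=> a0; apply: contrapT => H.
apply: (not_eventually_above (X := X) eps_gt0 eps_le tau_ge0 wD p_range pD a0) => x Xx.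
by rewrite leNgt; apply/negP => wx; apply: H; exists x.
Qed.

Lemma frequently_above (a X : R) : 0 < a -> exists2 x, X <= x & - w x < a.
Proof.
move=> a0; apply: contrapT => H.
apply: (not_eventually_below (X := X) eps_gt0 tau_ge0 wD p_range pD a0) => x Xx.
by rewrite lerNr leNgt; apply/negP => wx; apply: H; exists x.
Qed.

Let wND (x : R) : is_derive x 1 (fun x => - w x) (- p x).
Proof. exact: dopp (wD x). Qed.

Let pND (x : R) : is_derive x 1 (fun x => - p x) (- drift eps (p x) (w (x - tau))).
Proof. exact: dopp (pD x). Qed.

(** At a trough the level of time [tau] earlier is nonnegative, and the slope is
    at least [- Q] on the way down. *)
Lemma eventually_bounded_below : exists X, forall x, X <= x -> - w x <= `|Q| * (3 / 2) + 1.
Proof.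
have [t0 t1] := conj tau_ge0 tau_le.
set B := _ + 1; have B0 : 0 < B by have : 0 <= `|Q| by []; rewrite /B; lra.
apply: contrapT => H.
have hi X : exists2 x, X <= x & B < - w x.
  apply: contrapT => H'; apply: H; exists X => x Xx.
  by rewrite leNgt; apply/negP => ?; apply: H'; exists x.
have [s [_ Bs ps0 ds]] := late_maximum wND pND (fun X => frequently_above X B0) hi 0.
have {}ps0 : p s = 0 by lra.
have wst : 0 <= w (s - tau) by move: ds; rewrite oppr_le0 ps0 drift0_ge0.
have sts : s - tau <= s by lra.
have /andP[+ _] := level_increment wD p_range sts.
have -> : s - (s - tau) = tau by ring.
have : `|Q| * tau <= `|Q| * (3 / 2) by rewrite ler_wpM2l.
have : Q * tau <= `|Q| * tau by rewrite ler_wpM2r // ler_norm.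
by rewrite /B in Bs; lra.
Qed.

(** Crests of [w] later than the establishment of the bounds [- m <= w] and
    [p <= S] are governed by the envelope of these two parameters. *)
Lemma late_crests (m S X Gam : R) : 0 < m -> 0 < S ->
  (forall x, X <= x -> - m <= w x) -> 1 - expR (- m) <= S - eps * S ^+ 2 ->
  (forall G : R -> R, G 0 = 0 ->
     (forall x : R, -1 < x -> is_derive x 1 G (envelope m S x)) -> G (3 / 2) <= Gam) ->
  exists X', forall s, X' <= s -> 0 < w s -> p s = 0 ->
    drift eps (p s) (w (s - tau)) <= 0 ->
    (1 <= Gam -> w s <= 2 * Gam - 1) /\
    (Gam <= 1 -> w s <= 1 /\ w s + 2 / 3 * eps * (w s * (1 - w s)) <= Gam).
Proof.
have [e0 t0] := conj eps_gt0 tau_ge0.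
move=> m0 S0 wm GS GamP.
have pS := slope_upper_bound eps_gt0 tau_ge0 p_range pD wm GS.
exists (X + tau + 2 * tau) => s Xs ws ps ds.
have pmu x : p x <= (2 * eps)^-1 by case/andP: (p_range x).
have wm' x : X + tau <= x -> - m <= w x by move=> Xx; apply: wm; lra.
have [L [lam [wL Llam lam0 el LG]]] := crest_bound eps_gt0 eps_le tau_ge0 tau_le wD pD
  m0 S0 wm' pS Xs ps ds ws pmu GamP.
exact: crest_algebra wL Llam lam0 el LG eps_gt0 eps_le (ltW ws).
Qed.

Lemma limit_from_crests (M A : R) :
  (forall e : R, 0 < e -> forall X, exists2 x, X <= x & M - e < w x) -> 0 < A ->
  (exists X, forall s, X <= s -> A < w s -> p s = 0 ->
     drift eps (p s) (w (s - tau)) <= 0 -> False) -> M <= A.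
Proof.
move=> Mhi A0 [X XP]; rewrite leNgt; apply/negP => AM.
have hi Y : exists2 x, Y <= x & A < w x.
  have [|x Yx wx] := Mhi (M - A) _ Y; first by rewrite subr_gt0.
  by exists x => //; rewrite subKr in wx.
have [s [Xs As ps ds]] := late_maximum wD pD (fun Y => frequently_below Y A0) hi X.
exact: XP s Xs As ps ds.
Qed.

Lemma limit_from_troughs (M m X : R) :
  (forall e : R, 0 < e -> forall X, exists2 x, X <= x & m - e < - w x) ->
  0 < M <= 11 / 10 -> (forall x, X <= x -> w x <= M) -> m <= trough_map M.
Proof.
have [e0 t0] := conj eps_gt0 tau_ge0.
move=> mhi M01 wM; have /andP[M0 M1] := M01.
have A0 : 0 < trough_map M.
  have h k : 0 <= M ^+ k by rewrite exprn_ge0 ?ltW.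
  have := h 2%N; have := h 3%N; have := h 4%N; rewrite /trough_map; lra.
rewrite leNgt; apply/negP => Am.
have hi Y : exists2 x, Y <= x & trough_map M < - w x.
  have [|x Yx wx] := mhi (m - trough_map M) _ Y; first by rewrite subr_gt0.
  by exists x => //; rewrite subKr in wx.
have [s [Xs As ps ds]] :=
  late_maximum wND pND (fun Y => frequently_above Y A0) hi (X + tau + 2 * tau).
have pE := slope_lower_bound eps_gt0 tau_ge0 p_range pD M0 wM.
have wM' x : X + tau <= x -> w x <= M by move=> Xx; apply: wM; lra.
have {}ps : p s = 0 by lra.
have {}ds : 0 <= drift eps (p s) (w (s - tau)) by rewrite -oppr_le0.
have := trough_bound eps_gt0 tau_ge0 tau_le wD pD M0 wM' pE Xs ps ds.
have := trough_map_ge M01; lra.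
Qed.

Lemma crest_limit (M m X S Gam A : R) :
  (forall e : R, 0 < e -> forall X, exists2 x, X <= x & M - e < w x) ->
  0 < m -> 0 < S ->
  (forall x, X <= x -> - m <= w x) -> 1 - expR (- m) <= S - eps * S ^+ 2 ->
  (forall G : R -> R, G 0 = 0 ->
     (forall x : R, -1 < x -> is_derive x 1 G (envelope m S x)) -> G (3 / 2) <= Gam) ->
  0 < A -> (forall a, 0 < a -> (1 <= Gam -> a <= 2 * Gam - 1) ->
    (Gam <= 1 -> a <= 1 /\ a + 2 / 3 * eps * (a * (1 - a)) <= Gam) -> a <= A) ->
  M <= A.
Proof.
move=> Mhi m0 S0 wm GS GamP A0 HA; have [X' X'P] := late_crests m0 S0 wm GS GamP.
apply: (limit_from_crests Mhi A0); exists X' => s Xs As ps ds.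
have ws : 0 < w s := lt_trans A0 As.
have [G1 G2] := X'P s Xs ws ps ds.
by have := HA _ ws G1 G2; rewrite leNgt As.
Qed.

Lemma limit_le_ramp (M m X S A : R) :
  (forall e : R, 0 < e -> forall X, exists2 x, X <= x & M - e < w x) ->
  0 < m -> 0 < S -> (forall x, X <= x -> - m <= w x) ->
  1 - expR (- m) <= S - eps * S ^+ 2 -> 0 < A ->
  (forall a, 0 < a ->
    (1 <= 3 / 2 - (1 - expR (- (S * (3 / 2)))) / S ->
     a <= 2 * (3 / 2 - (1 - expR (- (S * (3 / 2)))) / S) - 1) ->
    (3 / 2 - (1 - expR (- (S * (3 / 2)))) / S <= 1 ->
     a <= 1 /\ a + 2 / 3 * eps * (a * (1 - a)) <=
       3 / 2 - (1 - expR (- (S * (3 / 2)))) / S) -> a <= A) ->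
  M <= A.
Proof.
move=> Mhi m0 S0 wm GS A0; apply: (crest_limit Mhi m0 S0 wm GS) => // G G0 GD.
have h : 0 <= 3 / 2 :> R by lra.
exact: (envelope_integral_ramp S0 G0 GD h).
Qed.

Lemma limit_le_crest_map (M m X : R) :
  (forall e : R, 0 < e -> forall X, exists2 x, X <= x & M - e < w x) ->
  0 < m <= 2 -> (forall x, X <= x -> - m <= w x) -> M <= crest_map m.
Proof.
move=> Mhi m02 wm; have /andP[m0 _] := m02.
have /andP[c0 _] := crest_map_bounds m02.
have [S [S0 GS mS GamS]] := envelope_slope eps_gt0 eps_le m02.
apply: (crest_limit Mhi m0 S0 wm GS) c0 _ => [G G0 GD|a a0 _ aG].
  exact: le_trans (envelope_integral S0 G0 GD m0 mS) GamS.
exact: le_crest_map eps_gt0 eps_le m02 a0 aG.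
Qed.

(** The slope bound [2] holds without any information on troughs, since
    [2 - 4 eps >= 1]; the delay then gives [2 Gam - 1 = 1 + exp (- 3)]. *)
Lemma limit_le_slope2 (M m X : R) :
  (forall e : R, 0 < e -> forall X, exists2 x, X <= x & M - e < w x) ->
  0 < m -> (forall x, X <= x -> - m <= w x) -> M <= 108 / 100.
Proof.
have [e0 e4] := conj eps_gt0 eps_le.
move=> Mhi m0 wm; apply: (limit_le_ramp (S := 2) Mhi m0 _ wm) => [|||a a0 + _].
- lra.
- by have := expR_gt0 (- m); lra.
- lra.
have -> : 2 * (3 / 2) = 3 :> R by field.
have := expR_gt0 (- 3 : R); have := @expRN3 R => h1 h2 /(_ ltac:(lra)).
lra.
Qed.

(** Troughs above [- 2.7] improve the slope bound to [3 / 2], as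
    [3 / 2 - 9 / 4 * eps >= 1 - exp (- 2.7)]. *)
Lemma limit_le_slope32 (M m X : R) :
  (forall e : R, 0 < e -> forall X, exists2 x, X <= x & M - e < w x) ->
  0 < m <= 27 / 10 -> (forall x, X <= x -> - m <= w x) -> M <= 93 / 100.
Proof.
have [e0 e4] := conj eps_gt0 eps_le.
move=> Mhi /andP[m0 m27] wm.
apply: (limit_le_ramp (S := 3 / 2) Mhi m0 _ wm) => [|||a a0 _].
- lra.
- have : expR (- (27 / 10)) <= expR (- m) by rewrite ler_expR; lra.
  by have := @expRN27 R; lra.
- lra.
have -> : 3 / 2 * (3 / 2) = 9 / 4 :> R by field.
have h := @expRN94 R => /(_ ltac:(lra))[a1 aG].
have : 0 <= eps * (a * (1 - a)) by apply: mulr_ge0; [lra|apply: mulr_ge0; lra].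
lra.
Qed.

(** The bounds for the limits superior [M] of [w] and [m] of [- w] are improved in
    turn, [M <= 1.08], [m <= 2.63], [M <= 0.93], [m < 2], until [m] is in the range
    where the sharp crest estimate holds. *)
Lemma converges_to_zero (e : R) : 0 < e -> exists X, forall x, X <= x -> `|w x| <= e.
Proof.
move=> e_gt0.
have [|M [_ Mub Mhi]] := @upper_limit R w kap (-1) 0 (fun x _ => w_le x).
  by move=> X; have [x Xx wx] := @frequently_above 1 X ltr01; exists x => //; lra.
have [X0 X0P] := eventually_bounded_below.
have [|m [_ mub mhi]] := @upper_limit R (fun x => - w x) _ (-1) X0 X0P.
  by move=> X; have [x Xx wx] := @frequently_below 1 X ltr01; exists x => //; lra.
have M0 : 0 <= M.
  rewrite leNgt; apply/negP => M0.
  have [|X XM] := Mub (- M / 2); first lra.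
  have [|x /XM wx] := @frequently_above (- M / 2) X; lra.
have m0 : 0 <= m.
  rewrite leNgt; apply/negP => m0.
  have [|X Xm] := mub (- m / 2); first lra.
  have [|x /Xm wx] := @frequently_below (- m / 2) X; lra.
have trough d : 0 < d -> M + d <= 11 / 10 -> m <= trough_map (M + d).
  move=> d0 Md; have [X XP] := Mub d d0.
  by apply: limit_from_troughs mhi _ XP; apply/andP; split; lra.
have below d : 0 < d -> exists X, forall x, X <= x -> - (m + d) <= w x.
  by move=> d0; have [X XP] := mub d d0; exists X => x /XP; lra.
have M108 : M <= 108 / 100.
  by have [X XP] := below 1 ltr01; apply: limit_le_slope2 Mhi _ XP; lra.
have m263 : m <= 263 / 100.
  apply: le_trans (trough (2 / 100) _ _) _; [lra|lra|].
  apply: le_trans (@trough_map_incr R _ (11 / 10) _ _) _; [lra|lra|].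
  rewrite /trough_map; lra.
have M93 : M <= 93 / 100.
  have [X XP] := below (7 / 100) ltac:(lra).
  by apply: limit_le_slope32 Mhi _ XP; apply/andP; split; lra.
have m_lt2 : m <= 399 / 200.
  apply: le_trans (trough (2 / 100) _ _) _; [lra|lra|].
  apply: le_trans (@trough_map_incr R _ (19 / 20) _ _) _; [lra|lra|].
  rewrite /trough_map; lra.
have crest d : 0 < d -> m + d <= 2 -> M <= crest_map (m + d).
  move=> d0 md; have [X XP] := below d d0.
  by apply: limit_le_crest_map Mhi _ XP; apply/andP; split; lra.
have [ME mE] := limits_vanish (introT andP (conj M0 M93)) (introT andP (conj m0 m_lt2)) trough crest.
rewrite ME in Mub; rewrite mE in mub.
have [X XP] := Mub e e_gt0; have [Y YP] := mub e e_gt0.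
exists (Num.max X Y) => x; rewrite ge_max => /andP[/XP wx /YP wx'].
by rewrite ler_norml; apply/andP; split; lra.
Qed.

End Convergence.

(** * Solutions of the profile equation *)

Section LogProfile.
Context {R : realType}.

(** The function [exp w] solves [eps v'' - v' + v (1 - v (x - tau)) = 0]. The cap
    is the level that can be gained with slope [mu] in time [3 / 2], plus one. *)
Lemma log_profile (eps tau : R) :
  0 < eps -> eps <= 1 / 4 -> 0 <= tau -> tau <= 3 / 2 ->
  exists w p : R -> R,
    [/\ forall x : R, is_derive x 1 w (p x),
        forall x : R, is_derive x 1 p (drift eps (p x) (w (x - tau))),
        exists X : R, forall x, x <= X -> w x <= (x - X) / 4 - 1
      & forall e : R, 0 < e -> exists X : R, forall x, X <= x -> `|w x| <= e].
Proof.
move=> e0 e4 t0 t1.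
pose mu := (2 * eps)^-1; have mu0 : 0 < mu by rewrite invr_gt0 mulr_gt0.
pose kap := mu * (3 / 2) + 1; pose Q := expR kap.
have Q0 : 0 < Q by exact: expR_gt0.
have QE : expR kap - 1 <= Q + eps * Q ^+ 2.
  have : 0 <= eps * Q ^+ 2 by nonneg.
  by rewrite -/Q; lra.
have [w [p [wD pD pQ w0 wneg]]] := entire_solution e0 e4 t0 Q0 QE.
have kap1 : -1 <= kap by rewrite /kap; nra.
have wkap : forall x, w x <= kap.
  apply: (cap_inactive e0 t0 t1 wD pQ pD (lexx _)) => x /wneg wx.
  exact: le_trans wx kap1.
have {}pD (x : R) : is_derive x 1 p (drift eps (p x) (w (x - tau))).
  by have := pD x; rewrite /rate min_l.
exists w, p; split => //.
  exact: climbs_from_minus_infinity e0 t0 wD pQ pD wneg.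
move=> e; exact: (converges_to_zero e0 e4 t0 t1 wD pD pQ wkap).
Qed.

End LogProfile.

(** * Smoothness of plane waves *)

Section Smoothness.
Context {R : realType}.
Implicit Types (f g : R -> R) (k : nat).

Fixpoint differentiable_times k f : Prop :=
  if k is k'.+1 then
    exists2 df : R -> R,
      forall x : R, is_derive x 1 f (df x) & differentiable_times k' df
  else True.

Lemma differentiable_times_pred k f :
  differentiable_times k.+1 f -> differentiable_times k f.
Proof.
elim: k f => [//|k IH] f [df fD dfk]; exists df => //; exact: IH.
Qed.

Lemma differentiable_times_cst k (a : R) : differentiable_times k (fun=> a).
Proof.
elim: k a => [//|k IH] a; exists (fun=> 0) => // x; exact: dcst.
Qed.

Lemma differentiable_timesD k f g : differentiable_times k f ->
  differentiable_times k g -> differentiable_times k (fun x => f x + g x).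
Proof.
elim: k f g => [//|k IH] f g [df fD dfk] [dg gD dgk].
by exists (fun x => df x + dg x) => [x|]; [exact: dadd|exact: IH].
Qed.

Lemma differentiable_timesM k f g : differentiable_times k f ->
  differentiable_times k g -> differentiable_times k (fun x => f x * g x).
Proof.
elim: k f g => [//|k IH] f g fk gk.
have fk' := differentiable_times_pred fk; have gk' := differentiable_times_pred gk.
case: fk gk => df fD dfk [dg gD dgk].
exists (fun x => df x * g x + f x * dg x) => [x|]; first exact: dmul.
by apply: differentiable_timesD; exact: IH.
Qed.

Lemma differentiable_times_shift k f (a : R) : differentiable_times k f ->
  differentiable_times k (fun x => f (x - a)).
Proof.
elim: k f => [//|k IH] f [df fD dfk]; exists (fun x => df (x - a)); last exact: IH.
by move=> x; exact: dshift.
Qed.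

(** The equation expresses the second derivative by polynomials in [v], its
    derivative and its translate, so it gains one derivative at a time. *)
Lemma delay_solution_smooth (eps tau : R) (v dv : R -> R) :
  (forall x : R, is_derive x 1 v (dv x)) ->
  (forall x : R, is_derive x 1 dv ((dv x - v x * (1 - v (x - tau))) / eps)) ->
  forall k, differentiable_times k v.
Proof.
move=> vD dvD; suff H k : differentiable_times k v /\ differentiable_times k dv.
  by move=> k; have [] := H k.
elim: k => [//|k [vk dvk]]; split; first by exists dv.
exists (fun x => (dv x - v x * (1 - v (x - tau))) / eps) => //.
apply: differentiable_timesM; last exact: differentiable_times_cst.
apply: differentiable_timesD => //.
have -> : (fun x => - (v x * (1 - v (x - tau)))) =
    (fun x => -1 * (v x * (1 + -1 * v (x - tau)))).
  by apply/funext => x; rewrite !mulN1r.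
apply: differentiable_timesM; first exact: differentiable_times_cst.
apply: differentiable_timesM => //.
apply: differentiable_timesD; first exact: differentiable_times_cst.
apply: differentiable_timesM; first exact: differentiable_times_cst.
exact: differentiable_times_shift.
Qed.

Section PlaneWaves.
Variables (V : normedModType R) (l : V -> R).
Hypothesis lE : forall (h : R) v x, l (h *: v + x) = h * l v + l x.

Lemma is_derive_along (f : V -> R) (x v : V) (d : R) :
  is_derive (0 : R) 1 (fun h : R => f (h *: v + x)) d -> is_derive x v f d.
Proof.
case=> fD fE; split; first by apply/derivable1P.
rewrite -fE /derive; apply: (congr1 (fun g : R -> R => lim (g @ (0 : R)^'))).
by apply/funext => h /=; rewrite addr0 scale0r add0r [_%:A]mulr1.
Qed.

Lemma is_derive_plane_wave (f df : R -> R) (a : R) (x v : V) :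
  (forall y : R, is_derive y 1 f (df y)) ->
  is_derive x v (fun x => a * f (l x)) (a * l v * df (l x)).
Proof.
move=> fD; apply: is_derive_along.
have -> : (fun h : R => a * f (l (h *: v + x))) = (fun h => a * f (l x + l v * h)).
  by apply/funext => h; congr (a * f _); rewrite lE addrC mulrC.
have hD : is_derive (0 : R) 1 (f \o (fun h => l x + l v * h)) (df (l x + l v * 0) * l v).
  exact: (is_derive1_comp (f:=f) (g:=fun h => l x + l v * h) (fD _) (daffine _ _ _)).
apply: is_derive_eq (dmul (dcst a 0) hD) _.
by rewrite mul0r add0r mulr0 addr0; ring.
Qed.

Lemma class_C_plane_wave : continuous l -> forall k (f : R -> R) (a : R),
  differentiable_times k.+1 f -> class_C k (fun x => a * f (l x)).
Proof.
move=> lc; elim=> [|k IH] f a [df fD dfk].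
  split=> // x; apply: cvgM; first exact: cvg_cst.
  by apply: continuous_comp; [exact: lc|exact: is_derive_continuous (fD _)].
split=> [x|v].
  apply: cvgM; first exact: cvg_cst.
  by apply: continuous_comp; [exact: lc|exact: is_derive_continuous (fD _)].
have D x := is_derive_plane_wave a x v fD.
split=> [x|]; first by have [] := D x.
have -> : 'D_v (fun x => a * f (l x)) = (fun x => a * l v * df (l x)).
  by apply/funext => x; have [_ ->] := D x.
exact: IH.
Qed.

End PlaneWaves.

End Smoothness.

Section Dot.
Context {R : realType}.

Lemma dotE (m : nat) (nu : 'rV[R]_m) (h : R) (v x : 'rV[R]_m) :
  dot nu (h *: v + x) = h * dot nu v + dot nu x.
Proof.
rewrite /dot mulr_sumr -big_split; apply: eq_bigr => i _.
by rewrite !mxE mulrDr mulrCA.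
Qed.

Lemma dot_delta (m : nat) (nu : 'rV[R]_m) (i : 'I_m) : dot nu (delta_mx 0 i) = nu 0 i.
Proof.
rewrite /dot (bigD1 i) //= mxE !eqxx mulr1 big1 ?addr0 // => j ji.
by rewrite mxE (negbTE ji) andbF mulr0.
Qed.

Lemma dot_unit (m : nat) (nu : 'rV[R]_m) : eucl_norm nu = 1 -> dot nu nu = 1.
Proof.
move=> nu1; have : 0 <= dot nu nu.
  by apply: sumr_ge0 => i _; rewrite -expr2 sqr_ge0.
by move=> /sqr_sqrtr <-; rewrite -[Num.sqrt _]/(eucl_norm nu) nu1 expr1n.
Qed.

Lemma continuous_dot (m : nat) (nu : 'rV[R]_m) : continuous (dot nu).
Proof.
apply: continuous_big => [|i _ x]; first exact: add_continuous.
by apply: continuousM; [exact: cst_continuous|exact: coord_continuous].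
Qed.

Lemma laplacian_plane_wave (m : nat) (nu : 'rV[R]_m) (b : R) (f df ddf : R -> R) x :
  dot nu nu = 1 ->
  (forall y : R, is_derive y 1 f (df y)) -> (forall y : R, is_derive y 1 df (ddf y)) ->
  laplacian (fun x => f (b * dot nu x)) x = b ^+ 2 * ddf (b * dot nu x).
Proof.
move=> nu1 fD dfD; pose l x := b * dot nu x.
have lE (h : R) v y : l (h *: v + y) = h * l v + l y.
  by rewrite /l dotE mulrDr mulrCA.
have -> : (fun x => f (b * dot nu x)) = (fun x => 1 * f (l x)).
  by apply/funext => y; rewrite mul1r.
rewrite /laplacian.
transitivity (\sum_(i < m) (nu 0 i * nu 0 i) * (b ^+ 2 * ddf (l x))).
  apply: eq_bigr => i _.
  have -> : 'D_(delta_mx 0 i) (fun x => 1 * f (l x)) =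
      (fun x => 1 * l (delta_mx 0 i) * df (l x)).
    by apply/funext => y; have [_ ->] := is_derive_plane_wave lE 1 y (delta_mx 0 i) fD.
  have [_ ->] := is_derive_plane_wave lE (1 * l (delta_mx 0 i)) x (delta_mx 0 i) dfD.
  by rewrite /l dot_delta; ring.
by rewrite -mulr_suml -/(dot nu nu) nu1 mul1r.
Qed.

End Dot.

(** * The front *)

Section Front.
Context {R : realType}.

Lemma delayed_front (eps tau : R) :
  0 < eps -> eps <= 1 / 4 -> 0 <= tau -> tau <= 3 / 2 ->
  exists v dv : R -> R,
    [/\ forall x : R, is_derive x 1 v (dv x),
        forall x : R, is_derive x 1 dv ((dv x - v x * (1 - v (x - tau))) / eps)
      & front_profile v].
Proof.
move=> e0 e4 t0 t1.
have [w [p [wD pD wneg w0]]] := log_profile e0 e4 t0 t1.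
pose v x := expR (w x); exists v, (fun x => v x * p x).
have vD (x : R) : is_derive x 1 v (v x * p x) by exact: dexp.
split=> // [x|].
  apply: is_derive_eq (dmul (vD x) (pD x)) _.
  by rewrite /drift /v; field; rewrite gt_eqF.
split=> [x||]; first exact: expR_gt0.
  have [X XP] := wneg; apply/cvgrPdist_le => e e_gt0.
  exists (Num.min X (X + 4 * (1 + ln e))); split=> [|x]; first exact: num_real.
  rewrite lt_min => /andP[/ltW /XP wx xX].
  rewrite sub0r normrN ger0_norm ?expR_ge0 // /v -(lnK (x := e)) ?posrE // ler_expR.
  lra.
rewrite -(expR0 R); apply: (@cvg_comp _ _ _ w expR _ (nbhs (0 : R))); last exact: continuous_expR.
apply/cvgrPdist_le => e e_gt0.
have [X XP] := w0 e e_gt0; exists X; split=> [|x /ltW xX]; first exact: num_real.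
by rewrite sub0r normrN; exact: XP.
Qed.

Lemma front_profile_scale (v : R -> R) (c : R) : 0 < c -> front_profile v ->
  front_profile (fun s => v (s / c)).
Proof.
move=> c0 [v0 vneg vpos]; split=> [s||]; first exact: v0.
  apply: cvg_comp vneg => A [M [_ MA]].
  exists (c * M); split=> [|s sM]; first exact: num_real.
  by apply: MA; rewrite ltr_pdivrMr // mulrC.
apply: cvg_comp vpos => A [M [_ MA]].
exists (c * M); split=> [|s sM]; first exact: num_real.
by apply: MA; rewrite ltr_pdivlMr // mulrC.
Qed.

End Front.

Theorem theorem1p1 (R : realType) (m : nat) (c tau : R)
    (m_ge1 : (1 <= m)%N) (c_ge2 : 2 <= c) (tau_ge0 : 0 <= tau)
    (tau_le : tau <= 3 / 2) (nu : 'rV[R]_m) (nu_unit : eucl_norm nu = 1) :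
  exists u : R -> 'rV[R]_m -> R, positive_traveling_front c tau nu u.
Proof.
have c0 : 0 < c by lra.
pose eps := (c ^+ 2)^-1; have e0 : 0 < eps by rewrite invr_gt0 exprn_gt0.
have e4 : eps <= 1 / 4.
  rewrite div1r lef_pV2 ?posrE ?exprn_gt0 //; nra.
have [v [dv [vD dvD vF]]] := delayed_front e0 e4 tau_ge0 tau_le.
exists (fun t x => v (c^-1 * dot nu x + t)); split; last first.
  exists (fun s => v (s / c)); split; first exact: front_profile_scale.
  by move=> t x; congr v; field; rewrite gt_eqF.
split=> [|t x|t x]; last 1 first.
- rewrite (laplacian_plane_wave c^-1 x (dot_unit nu_unit)
    (fun y => dshift (vD (y + t))) (fun y => dshift (dvD (y + t)))) derive1E.
  have tD : is_derive t 1 (fun s => v (c^-1 * dot nu x + s)) (dv (c^-1 * dot nu x + t)).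
    have -> : (fun s => v (c^-1 * dot nu x + s)) = (fun s => v (s + c^-1 * dot nu x)).
      by apply/funext => s; rewrite addrC.
    by rewrite addrC; exact: dshift.
  have [_ ->] := tD.
  have -> : c^-1 * dot nu x + (t - tau) = c^-1 * dot nu x + t - tau by ring.
  by rewrite /eps; field; rewrite gt_eqF.
- move=> k.
  pose l (q : R * 'rV[R]_m) : R := c^-1 * dot nu q.2 + q.1.
  have lE (h : R) a b : l (h *: a + b) = h * l a + l b.
    rewrite /l -[(h *: a + b).1]/(h * a.1 + b.1) -[(h *: a + b).2]/(h *: a.2 + b.2).
    by rewrite dotE; ring.
  have -> : (fun q : R * 'rV[R]_m => v (c^-1 * dot nu q.2 + q.1)) =
      (fun q => 1 * v (l q)).
    by apply/funext => q; rewrite mul1r.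
  apply: (class_C_plane_wave lE); last exact: delay_solution_smooth vD dvD _.
  move=> q; apply: cvgD; last exact: cvg_fst.
  apply: cvgM; first exact: cvg_cst.
  by apply: continuous_comp; [exact: cvg_snd|exact: continuous_dot].
- by case: vF.
Qed.
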